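(* Let $p\in(0,\frac12)$. For (Lebesgue) almost every $\lambda\in(\frac12,\min(\lambda_*,1-p))$ the following holds: the set $\Delta_{\nu_\lambda^p}(\alpha)$ has positive Hausdorff dimension for almost every $\alpha$ in $$J(p,\lambda)=\left[\frac{\log(1-p)}{\log\lambda},\,1\right].$$ More precisely, $$\dim_H(\Delta_{\nu_\lambda^p}(\alpha))\ge\frac{h(q)}{|\log\lambda|}\quad\text{for almost every }\alpha\in J(p,\lambda),$$ where $\alpha$ and $q$ are related by $\alpha\log\lambda=q\log p+(1-q)\log(1-p)$.
   Context: For $\lambda,p\in(0,1)$, $\nu_\lambda^p$ denotes the $p$-biased Bernoulli convolution: the distribution of the random series $\sum_{n\ge1}i_n\lambda^n$, where the $i_n$ are i.i.d. taking values $0,1$ with probabilities $p,1-p$. For a measure $\mu$ on $\mathbb R$, $d(\mu,x)=\lim_{r\searrow0}\frac{\log\mu(B(x,r))}{\log r}$ when the limit exists, and $\Delta_\mu(\alpha)=\{x\in\mathbb R:d(\mu,x)\text{ exists and equals }\alpha\}$. $\dim_H$ is Hausdorff dimension. $h(q)=-q\log q-(1-q)\log(1-q)$. For $\mathbf i\in\{0,1\}^{\mathbb N}$ let $\Pi_\lambda(\mathbf i)=\sum_{n\ge1}i_n\lambda^n$. The number $\lambda_*\in(\frac12,1)$ is one with the following transversality property: there is a constant $C>0$ such that for all $\mathbf i,\mathbf j\in\{0,1\}^{\mathbb N}$ with $i_1\ne j_1$ and all $\delta>0$, the Lebesgue measure of $\{\lambda\in(0,\lambda_* ):|\Pi_\lambda(\mathbf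 i)-\Pi_\lambda(\mathbf j)|<\delta\}$ is less than $C\delta$. It is known that $\lambda_*=0.66847$ has this property, and one may take this value. *)

(* Defs.v *)
From HB Require Import structures.
From mathcomp Require Import all_boot all_order all_algebra finmap.
From mathcomp Require Import all_classical all_reals all_analysis.

Set Implicit Arguments.
Unset Strict Implicit.
Unset Printing Implicit Defensive.

Import Order.TTheory GRing.Theory Num.Theory.
Import numFieldNormedType.Exports.

Local Open Scope classical_set_scope.
Local Open Scope ring_scope.

(* Sequences are indexed from 0, so [i n] is the digit $i_{n+1}$ and
   [coding lam i] is $\Pi_\lambda(i) = \sum_{n \ge 1} i_n \lambda^n$. *)
Definition coding (R : realType) (lam : R) (i : nat -> bool) : R :=
  limn (series (fun n => (i n)%:R * lam ^+ n.+1)).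

Definition transversality (R : realType) (lstar : R) : Prop :=
  exists2 C : R, 0 < C &
    forall i j : nat -> bool, i 0%N != j 0%N ->
    forall delta : R, 0 < delta ->
      (lebesgue_measure
         [set lam : R | 0 < lam < lstar
                        /\ `|coding lam i - coding lam j| < delta]%R
       < (C * delta)%:E)%E.

Definition mutually_independent (R : realType) (d d' : measure_display)
    (Omega : measurableType d) (T : measurableType d')
    (P : probability Omega R) (X : nat -> {RV P >-> T}) : Prop :=
  forall (I : {fset nat}) (E : nat -> set T),
    (forall k, measurable (E k)) ->
    P (\bigcap_(k in [set` I]) (X k @^-1` E k))
      = (\prod_(k <- I) P (X k @^-1` E k))%E.

Definition biased_iid_digits (R : realType) (p : R) (d : measure_display)
    (Omega : measurableType d) (P : probability Omega R)
    (X : nat -> {RV P >-> bool}) : Prop :=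
  mutually_independent X
  /\ forall n, P (X n @^-1` [set false]) = p%:E
            /\ P (X n @^-1` [set true]) = (1 - p)%:E.

(* $\nu_\lambda^p$ when [X] satisfies [biased_iid_digits p]; the law does not
   depend on the choice of the probability space or of [X]. *)
Definition bernoulli_convolution (R : realType) (lam : R) (d : measure_display)
    (Omega : measurableType d) (P : probability Omega R)
    (X : nat -> {RV P >-> bool}) : set R -> \bar R :=
  pushforward P (fun w => coding lam (fun n => X n w)).

(* The quotient is extended-real valued: real [ln] has [ln 0 = 0], which would
   give points outside the support local dimension 0 instead of +oo. *)
Definition has_local_dim (R : realType) (mu : set R -> \bar R) (x alpha : R) :
    Prop :=
  (lne (mu (ball x r)) * ((ln r)^-1)%:E)%E @[r --> (0 : R)^'+] --> alpha%:E.

Definition level_set (R : realType) (mu : set R -> \bar R) (alpha : R) :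
    set R :=
  [set x | has_local_dim mu x alpha].

(* 0 is added so that the empty set has diameter 0 rather than -oo. *)
Definition diam (R : realType) (U : set R) : \bar R :=
  ereal_sup (0%E |` [set (`|z.1 - z.2|)%:E | z in U `*` U]).

Definition hausdorff_premeasure (R : realType) (s delta : R) (A : set R) :
    \bar R :=
  ereal_inf [set (\sum_(0 <= n <oo) poweR (diam (U n)) s)%E | U in
    [set U : nat -> set R | A `<=` \bigcup_n U n
                            /\ forall n, (diam (U n) <= delta%:E)%E]].

Definition hausdorff_measure (R : realType) (s : R) (A : set R) : \bar R :=
  ereal_sup [set hausdorff_premeasure s delta A | delta in
    [set delta : R | 0 < delta]].

(* Restricting to [0 < s] avoids the convention for [0 `^ 0] and does not change
   the infimum; in particular the empty set has dimension 0. *)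
Definition hausdorff_dim (R : realType) (A : set R) : \bar R :=
  ereal_inf [set s%:E | s in
    [set s : R | 0 < s /\ hausdorff_measure s A = 0%E]].

(* [ln 0 = 0] gives the usual convention $0 \log 0 = 0$. *)
Definition entropy (R : realType) (q : R) : R :=
  - (q * ln q) - (1 - q) * ln (1 - q).

(* Main.v *)
(* Let m_q be the law of iid digits equal to 0 with probability q, and let x be
   the point coded by an m_q-typical digit sequence i.  The level-n cylinder of i
   has p-mass about exp(n (q log p + (1 - q) log (1 - p))) = lambda^(n alpha), which
   bounds the upper local dimension of nu_lambda^p at x by alpha.  For the lower
   local dimension, fix i and integrate over lambda the p-mass of the words w with
   |Pi_lambda(w) - Pi_lambda(i)| < K lambda^n: grouping the words by the length k of
   the prefix they share with i, transversality bounds this by a multiple of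
   sum_k p-mass(i|k) b^(n - k) for lambda < b, which is of the expected order since
   alpha <= 1.  So the bound holds for all i and almost every lambda, hence by Fubini
   for almost every lambda, almost every q and m_q-almost every i; as alpha is affine
   in q, almost every q amounts to almost every alpha.  The same estimate with p
   replaced by q shows that the coded measure of m_q has mass at most about
   r^(h(q)/|log lambda|) in balls of radius r, and the mass distribution principle
   bounds the Hausdorff dimension of the level set from below.  Gibbs' inequality
   gives h(q)/|log lambda| <= alpha <= 1. *)

Require Import Defs.
From HB Require Import structures.
From mathcomp Require Import all_boot all_order all_algebra finmap.
From mathcomp Require Import all_classical all_reals all_analysis.
From mathcomp Require Import measurable_realfun ring lra.

Set Implicit Arguments.
Unset Strict Implicit.
Unset Printing Implicit Defensive.

Import Order.TTheory GRing.Theory Num.Theory.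
Import numFieldNormedType.Exports.

Local Open Scope classical_set_scope.
Local Open Scope ring_scope.

(** * Finite binary words and their Bernoulli weights *)

Section words.
Context (R : realType).
Implicit Types (q : R) (w : seq bool).

Definition bias q (x : bool) : R := if x then 1 - q else q.

Definition weight q w : R := \prod_(x <- w) bias q x.

Fixpoint words n : seq (seq bool) :=
  if n is m.+1 then map (cons false) (words m) ++ map (cons true) (words m)
  else [:: [::]].

Lemma mem_words n w : (w \in words n) = (size w == n).
Proof.
elim: n w => [|n IH] [|x w] //=.
  by rewrite mem_cat; apply/negbTE/norP; split; apply/negP => /mapP[].
rewrite mem_cat eqSS -IH; case: x.
  rewrite orbC [_ \in map (cons true) _]mem_map ?orbF; last by move=> ? ? [].
  by case: (w \in words n) => //=; apply/negbTE/negP => /mapP[].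
rewrite [_ \in map (cons false) _]mem_map; last by move=> ? ? [].
by case: (w \in words n) => //=; apply/negbTE/negP => /mapP[].
Qed.

Lemma words_uniq n : uniq (words n).
Proof.
elim: n => //= n IH; rewrite cat_uniq !map_inj_uniq ?IH /= ?andbT; try by move=> ? ? [].
by apply/hasPn => w /mapP[v _ ->]; apply/negP => /mapP[].
Qed.

(** Distributivity, by induction on the first letter. The factor may depend on the position, so the
    lemma serves both for prefix conditions and for moments of products. *)
Lemma sum_words_prod n (f : nat -> bool -> R) :
  \sum_(w <- words n) \prod_(k < n) f k (nth false w k)
  = \prod_(k < n) (f k false + f k true).
Proof.
elim: n f => [|n IH] f /=; first by rewrite big_seq1 !big_ord0.
rewrite big_cat /= !big_map big_ord_recl mulrDl.
rewrite -(IH (fun k => f k.+1)) !mulr_sumr; congr (_ + _).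
- by apply: eq_bigr => w _; rewrite big_ord_recl.
- by apply: eq_bigr => w _; rewrite big_ord_recl.
Qed.

Lemma weightE q n w : size w = n ->
  weight q w = \prod_(k < n) bias q (nth false w k).
Proof. by move=> <-; rewrite /weight (big_nth false) big_mkord. Qed.

Lemma bias_ge0 q x : 0 <= q <= 1 -> 0 <= bias q x.
Proof. by move=> /andP[q0 q1]; case: x => //=; rewrite subr_ge0. Qed.

Lemma bias_gt0 q x : 0 < q < 1 -> 0 < bias q x.
Proof. by move=> /andP[q0 q1]; case: x => //=; rewrite subr_gt0. Qed.

Lemma weight_ge0 q w : 0 <= q <= 1 -> 0 <= weight q w.
Proof. by move=> q01; apply: prodr_ge0 => x _; exact: bias_ge0. Qed.

Lemma weight_gt0 q w : 0 < q < 1 -> 0 < weight q w.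
Proof. by move=> q01; apply: prodr_gt0 => x _; exact: bias_gt0. Qed.

Lemma weight_rcons q w x : weight q (rcons w x) = weight q w * bias q x.
Proof. by rewrite /weight -cats1 big_cat big_seq1. Qed.

(** Agreement with [i] on the first k letters is a condition on each position separately, so the sum
    factorises; every position from k on contributes q + (1 - q) = 1. *)
Lemma sum_weight_prefix q (i : nat -> bool) k n : (k <= n)%N ->
  \sum_(w <- words n) weight q w * (mkseq (nth false w) k == mkseq i k)%:R
  = weight q (mkseq i k).
Proof.
move=> kn.
pose f j x := bias q x * ((j < k)%N ==> (x == i j))%:R.
have wE w : w \in words n ->
    weight q w * (mkseq (nth false w) k == mkseq i k)%:R
    = \prod_(j < n) f j (nth false w j).
  rewrite mem_words => /eqP sw; rewrite (weightE q sw) big_split /=; congr (_ * _).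
  rewrite -natr_prod; congr (_ %:R).
  have -> : (mkseq (nth false w) k == mkseq i k)
      = [forall j : 'I_n, (j < k)%N ==> (nth false w j == i j)].
    apply/eqP/forallP => [e j|h].
      apply/implyP => jk; have := congr1 (fun s => nth false s j) e.
      by rewrite !nth_mkseq// => ->.
    apply/eq_in_map => j; rewrite mem_iota add0n => /= jk.
    by have /implyP/(_ jk)/eqP := h (Ordinal (leq_trans jk kn)).
  case: forallP => [h|/forallP]; first by rewrite big1// => j _; rewrite h.
  by rewrite negb_forall => /existsP[j /negbTE h]; rewrite (bigD1 j)//= h mul0n.
rewrite big_seq (eq_bigr _ wE) -big_seq sum_words_prod.
rewrite (weightE q (size_mkseq _ _)).
rewrite -(subnKC kn) big_split_ord /= [X in _ * X]big1 ?mulr1.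
  apply: eq_bigr => j _; rewrite /f ltn_ord /= nth_mkseq//.
  by case: (i j) => /=; rewrite mulr0 ?mulr1 ?add0r ?addr0.
by move=> j _; rewrite /f /= ltnNge leq_addr /= /bias; lra.
Qed.

End words.

(** * An almost everywhere bound from geometrically decaying integrals *)

Section ae_bounded.
Context d (T : measurableType d) (R : realType) (mu : {measure set T -> \bar R}).

(** The n-th sum has integral at most B rho^n, so the series of all these sums is integrable and
    hence finite almost everywhere; its value bounds each of its nonnegative terms. *)
Lemma ae_bounded_step (I : Type) (r : nat -> seq I) (a : nat -> I -> R)
    (E : nat -> I -> set T) (B rho : R) :
  (forall n i, 0 <= a n i) -> (forall n i, measurable (E n i)) ->
  0 <= rho < 1 ->
  (forall n, \sum_(i <- r n) (a n i)%:E * mu (E n i) <= (B * rho ^+ n)%:E)%E ->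
  {ae mu, forall x, exists M : R, forall n,
    \sum_(i <- r n) a n i * \1_(E n i) x <= M}.
Proof.
move=> a0 mE /andP[rho0 rho1] leB.
pose f n x : \bar R := (\sum_(i <- r n) (a n i)%:E * (\1_(E n i) x)%:E)%E.
have f0 n x : (0 <= f n x)%E.
  by apply: sume_ge0 => i _; rewrite -EFinM lee_fin mulr_ge0 ?a0// indicE.
have mf n : measurable_fun setT (f n).
  apply: emeasurable_sum => i.
  by apply: measurable_funeM; apply/measurable_EFinP; exact: measurable_indic.
have If n : (\int[mu]_x f n x <= (B * rho ^+ n)%:E)%E.
  apply: le_trans (leB n); rewrite /f ge0_integral_sum//; last 2 first.
  - by move=> i; apply: measurable_funeM; apply/measurable_EFinP; exact: measurable_indic.
  - by move=> i x _; rewrite -EFinM lee_fin mulr_ge0 ?a0// indicE.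
  apply: lee_sum => i _.
  rewrite (@ge0_integralZl_EFin _ _ _ mu _ measurableT (fun x => (\1_(E n i) x)%:E))//.
  - by rewrite integral_indic// setIT.
  - by apply/measurable_EFinP; exact: measurable_indic.
pose F x := (\sum_(n <oo) f n x)%E.
have mF : measurable_fun setT F.
  by apply: (ge0_emeasurable_sum (P := xpredT)) => // n x _ _; exact: f0.
have B0 : 0 <= B.
  have := leB 0%N; rewrite expr0 mulr1 -lee_fin; apply: le_trans.
  by apply: sume_ge0 => i _; rewrite mule_ge0 ?lee_fin.
have iF : mu.-integrable setT F.
  apply/integrableP; split => //.
  under eq_integral do rewrite gee0_abs ?nneseries_ge0//.
  rewrite integral_nneseries//.
  apply: (@le_lt_trans _ _ (\sum_(n <oo) (B * rho ^+ n)%:E)%E).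
    by apply: lee_nneseries => // n _ _; exact: integral_ge0.
  rewrite (_ : limn _ = (B * (1 - rho)^-1)%:E) ?ltry//.
  apply/cvg_lim => //; under eq_fun do rewrite sumEFin.
  apply: cvg_EFin; first exact: nearW.
  by apply: (@cvg_geometric_series R B rho); rewrite ger0_norm.
have := integrable_ae measurableT iF; apply: filterS => x /(_ Logic.I) Fx.
exists (fine (F x)) => n; rewrite -lee_fin fineK// -sumEFin.
under eq_bigr do rewrite EFinM.
rewrite -/(f n x); apply: le_trans (nneseries_lim_ge n.+1 _) => //.
by rewrite big_nat_recr//= leeDr// sume_ge0.
Qed.

End ae_bounded.

(** * Independent biased digits realised on the unit interval *)

Section digits.
Context (R : realType).
Implicit Types (q u : R) (w : seq bool).
Notation leb := (@lebesgue_measure R).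

Definition refine q (s : R * R) (x : bool) : R * R :=
  if x then (s.1 + q * s.2, (1 - q) * s.2) else (s.1, q * s.2).

(* The interval of word [w], as (left end, length). *)
Definition subinterval q w := foldl (refine q) (0, 1) w.

(** The intervals are half-open so that those of the words of a given length partition [0, 1[. *)
Definition cylinder q w : set R :=
  `[(subinterval q w).1, (subinterval q w).1 + weight q w[.

Fixpoint digit_state q u n : R * R :=
  if n is m.+1 then
    let s := digit_state q u m in refine q s (s.1 + q * s.2 <= u)
  else (0, 1).

(* If [u] is uniform on [0, 1[, its digits are iid, equal to false with probability q. *)
Definition digit q u n := (digit_state q u n).1 + q * (digit_state q u n).2 <= u.

Lemma digit_stateE q u n : digit_state q u n = subinterval q (mkseq (digit q u) n).
Proof.
elim: n => //= n IH; rewrite mkseqS /subinterval foldl_rcons.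
by rewrite -[foldl _ _ _]/(subinterval _ _) -IH.
Qed.

Lemma subinterval2 q w : (subinterval q w).2 = weight q w.
Proof.
elim/last_ind: w => [|w x IH]; first by rewrite /weight big_nil.
rewrite weight_rcons /subinterval foldl_rcons /= -/(subinterval q w) -IH mulrC.
by case: x => /=; rewrite mulrC.
Qed.

Lemma cylinder_nil q : cylinder q [::] = `[0, 1[%classic.
Proof. by rewrite /cylinder /weight big_nil add0r. Qed.

Lemma cylinder_rcons_false q w u : 0 < q < 1 ->
  cylinder q (rcons w false) u =
    (cylinder q w u /\ u < (subinterval q w).1 + q * weight q w) :> Prop.
Proof.
move=> q01; have := weight_gt0 w q01; move: q01 => /andP[q0 q1] w0.
rewrite /cylinder weight_rcons /subinterval foldl_rcons /= -/(subinterval q w).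
have h : (subinterval q w).1 + q * weight q w <= (subinterval q w).1 + weight q w.
  by rewrite lerD2l ger_pMl// ltW.
rewrite !in_itv /= [weight q w * q]mulrC; apply/propext; split=> [/andP[-> h1]|[/andP[-> _] ->]//].
by rewrite (lt_le_trans h1).
Qed.

Lemma cylinder_rcons_true q w u : 0 < q < 1 ->
  cylinder q (rcons w true) u =
    (cylinder q w u /\ (subinterval q w).1 + q * weight q w <= u) :> Prop.
Proof.
move=> q01; have := weight_gt0 w q01; move: q01 => /andP[q0 q1] w0.
rewrite /cylinder weight_rcons /subinterval foldl_rcons /= -/(subinterval q w).
rewrite subinterval2 !in_itv /=.
have -> : (subinterval q w).1 + q * weight q w + weight q w * (1 - q)
   = (subinterval q w).1 + weight q w by ring.
apply/propext; split=> [/andP[h ->]|[/andP[_ ->] ->]//].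
by rewrite h andbT; split => //; apply: le_trans h; rewrite lerDl mulr_ge0// ltW.
Qed.

Lemma cylinder_digit q u n : 0 < q < 1 -> 0 <= u < 1 ->
  cylinder q (mkseq (digit q u) n) u.
Proof.
move=> q01 u01; elim: n => [|n IH]; first by rewrite cylinder_nil /= in_itv.
rewrite mkseqS; set w := mkseq _ _ in IH *.
have : digit q u n = ((subinterval q w).1 + q * weight q w <= u).
  by rewrite /digit digit_stateE subinterval2.
case: (digit q u n) => /esym h; first by rewrite cylinder_rcons_true.
by rewrite cylinder_rcons_false//; split => //; rewrite ltNge h.
Qed.

(** Converse of [cylinder_digit]: each endpoint test can be read off from membership in the
    cylinder. Cylinders of distinct words of equal length are therefore disjoint. *)
Lemma digit_cylinder q u w : 0 < q < 1 ->
  cylinder q w u -> mkseq (digit q u) (size w) = w.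
Proof.
move=> q01; elim/last_ind: w => [//|w x IH].
rewrite size_rcons mkseqS => wu.
have {wu}[/IH wE xE] : cylinder q w u /\ ((subinterval q w).1 + q * weight q w <= u) = x.
  by case: x wu => [|]; rewrite ?cylinder_rcons_true ?cylinder_rcons_false// => -[? h]; split => //;
    apply/negbTE; rewrite -ltNge.
by rewrite /digit digit_stateE wE subinterval2 xE.
Qed.

Lemma measurable_cylinder q w : measurable (cylinder q w).
Proof. exact: measurable_itv. Qed.

Lemma lebesgue_cylinder q w : 0 < q < 1 -> leb (cylinder q w) = (weight q w)%:E.
Proof.
move=> q01; rewrite /cylinder lebesgue_measure_itv /= lte_fin.
by rewrite ltrDl weight_gt0// -EFinD addrAC subrr add0r.
Qed.

Lemma sum_cylinder q u n (F : seq bool -> R) : 0 < q < 1 -> 0 <= u < 1 ->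
  \sum_(w <- words n) F w * \1_(cylinder q w) u = F (mkseq (digit q u) n).
Proof.
move=> q01 u01; have cu := cylinder_digit n q01 u01.
rewrite (bigD1_seq (mkseq (digit q u) n)) ?words_uniq ?mem_words ?size_mkseq//=.
rewrite indicE mem_set// mulr1 big_seq_cond big1 ?addr0// => w.
rewrite mem_words => /andP[/eqP sw wn].
rewrite indicE memNset ?mulr0// => /(digit_cylinder q01) e.
by rewrite -e sw eqxx in wn.
Qed.

(** As a function of t the left side has value 1 and negative slope q a + (1 - q) b at t = 0. A
    quadratic upper bound for the exponential makes an explicit t work. *)
Lemma small_moment (q a b : R) : 0 < q < 1 -> q * a + (1 - q) * b < 0 ->
  exists2 t : R, 0 < t & q * expR (t * a) + (1 - q) * expR (t * b) < 1.
Proof.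
move=> /andP[q0 q1] h.
(* From 1 - x <= exp(-x) and (1 - x)(1 + x + 2 x^2) = 1 + x^2 (1 - 2 x) >= 1. *)
have expU (x : R) : x <= 1 / 2 -> expR x <= 1 + x + 2 * x ^+ 2.
  move=> x2; have e := expR_ge1Dx (- x); rewrite expRN in e.
  have x0 : 0 < expR x by exact: expR_gt0.
  have h1 : (1 - x) * expR x <= 1 by rewrite -ler_pdivlMr// mul1r.
  have : (1 - x) * expR x <= (1 - x) * (1 + x + 2 * x ^+ 2) by nra.
  by rewrite ler_pM2l//; lra.
pose m := q * a + (1 - q) * b; pose s := 1 + q * a ^+ 2 + (1 - q) * b ^+ 2.
have s0 : 0 < s by rewrite /s; nra.
(* The first bound makes the second-order term 2 t s at most -m / 2; the second gives t a <= 1/2 and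
   t b <= 1/2, the range of [expU]. *)
pose t := Num.min (- m / (4 * s)) (1 / (2 * (1 + `|a| + `|b|))).
have ab0 : 0 < 1 + `|a| + `|b| by rewrite -addrA ltr_pwDl// addr_ge0.
have t0 : 0 < t by rewrite lt_min !divr_gt0// ?mulr_gt0// /m; lra.
exists t => //.
have t1 : t * (1 + `|a| + `|b|) <= 1 / 2.
  have -> : 1 / 2 = 1 / (2 * (1 + `|a| + `|b|)) * (1 + `|a| + `|b|).
    by field; rewrite lt0r_neq0.
  by rewrite ler_pM2r// ge_min lexx orbT.
have t2 : t * (4 * s) <= - m by rewrite -ler_pdivlMr ?mulr_gt0// ge_min lexx.
have ha : t * a <= 1 / 2.
  apply: le_trans t1; rewrite ler_pM2l//; have := ler_norm a; have := normr_ge0 b; lra.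
have hb : t * b <= 1 / 2.
  apply: le_trans t1; rewrite ler_pM2l//; have := ler_norm b; have := normr_ge0 a; lra.
have := expU _ ha; have := expU _ hb => eb ea.
apply: (@le_lt_trans _ _ (q * (1 + t * a + 2 * (t * a) ^+ 2)
   + (1 - q) * (1 + t * b + 2 * (t * b) ^+ 2))).
  by apply: lerD; rewrite ler_pM2l// subr_gt0.
have -> : q * (1 + t * a + 2 * (t * a) ^+ 2)
   + (1 - q) * (1 + t * b + 2 * (t * b) ^+ 2) = 1 + t * (m + 2 * t * (s - 1)).
  by rewrite /m /s; ring.
have : t * (m + 2 * t * (s - 1)) < 0; last lra.
rewrite pmulr_rlt0//; have : m < 0 by [].
by nra.
Qed.

(* The t-th moment of the product decays geometrically for small t > 0. *)
Lemma ae_prod_digit_bounded (q y0 y1 : R) : 0 < q < 1 -> 0 < y0 -> 0 < y1 ->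
  q * ln y0 + (1 - q) * ln y1 < 0 ->
  {ae leb, forall u, 0 <= u < 1 -> exists A : R, forall n,
    \prod_(x <- mkseq (digit q u) n) (if x then y1 else y0) <= A}.
Proof.
move=> q01 y00 y10 /(small_moment q01)[t t0 rho1].
set rho := (X in X < 1) in rho1.
pose z (x : bool) : R := (if x then y1 else y0) `^ t.
pose Z w := \prod_(x <- w) z x.
have rho0 : 0 <= rho.
  by case/andP: q01 => q0 q1; rewrite addr_ge0// mulr_ge0 ?expR_ge0 ?subr_ge0 ?ltW.
have z0 x : 0 <= z x by exact: powR_ge0.
have Z0 w : 0 <= Z w by apply: prodr_ge0.
(* The expectation of [Z] over words of length n is a product of n copies of the one-digit moment
   [rho]. *)
have ZE n : \sum_(w <- words n) Z w * weight q w = rho ^+ n.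
  rewrite big_seq.
  transitivity (\sum_(w <- words n | w \in words n)
      \prod_(k < n) (z (nth false w k) * bias q (nth false w k))).
    apply: eq_bigr => w; rewrite mem_words => /eqP sw; rewrite /Z.
    by rewrite (weightE q sw) big_split /= -sw (big_nth false) big_mkord.
  rewrite -big_seq (sum_words_prod n (fun _ x => z x * bias q x)) /=.
  rewrite prodr_const card_ord; congr (_ ^+ n).
  by rewrite /rho /z /powR !gt_eqF// mulrC [_ * (1 - q)]mulrC.
have Zle n : (\sum_(w <- words n) (Z w)%:E * leb (cylinder q w) <= (1 * rho ^+ n)%:E)%E.
  rewrite mul1r -ZE -sumEFin; under eq_bigr do rewrite lebesgue_cylinder//.
  by under eq_bigr do rewrite -EFinM.
have rho01 : 0 <= rho < 1 by rewrite rho0.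
have := @ae_bounded_step _ _ R leb _ words (fun=> Z) (fun=> cylinder q) 1 rho
  (fun=> Z0) (fun=> measurable_cylinder q) rho01 Zle.
apply: filterS => u [M hM] u01; exists (M `^ t^-1) => n.
have := hM n; rewrite sum_cylinder// => ZM.
have -> : \prod_(x <- mkseq (digit q u) n) (if x then y1 else y0)
    = (Z (mkseq (digit q u) n)) `^ t^-1.
  rewrite /Z; elim: (mkseq _ _) => [|x w IH]; first by rewrite !big_nil powR1.
  rewrite !big_cons powRM ?prodr_ge0// -IH /z -powRrM mulfV ?gt_eqF// powRr1//.
  by case: (x); exact: ltW.
apply: ge0_ler_powR (ZM); rewrite ?nnegrE ?invr_ge0 ?(ltW t0)//.
exact: le_trans ZM.
Qed.

End digits.

(** * The coding map: self-similarity and measurability *)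

Section coding.
Context (R : realType).
Implicit Types (lam : R) (i j : nat -> bool).

Definition shift_digits k i : nat -> bool := fun n => i (k + n)%N.

Lemma is_cvg_coding lam i : 0 <= lam < 1 ->
  cvgn (series (fun n => (i n)%:R * lam ^+ n.+1)).
Proof.
move=> /andP[l0 l1]; apply: (@series_le_cvg _ _ (geometric lam lam)).
- by move=> n; rewrite mulr_ge0 ?ler0n ?exprn_ge0.
- by move=> n; rewrite /= mulr_ge0 ?exprn_ge0.
- by move=> n; rewrite /= exprS ler_piMl ?mulr_ge0 ?exprn_ge0 ?lern1 ?leq_b1.
- by apply: is_cvg_geometric_series; rewrite ger0_norm.
Qed.

Lemma coding_cvg lam i : 0 <= lam < 1 ->
  series (fun n => (i n)%:R * lam ^+ n.+1) @ \oo --> coding lam i.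
Proof. by move=> l01; exact: is_cvg_coding. Qed.

Lemma coding_ge0 lam i : 0 <= lam < 1 -> 0 <= coding lam i.
Proof.
move=> l01; apply: limr_ge; first exact: is_cvg_coding.
apply: nearW => n; rewrite /series /= sumr_ge0// => k _.
by case/andP: l01 => l0 _; rewrite mulr_ge0 ?ler0n ?exprn_ge0.
Qed.

Lemma coding_le lam i : 0 <= lam < 1 -> coding lam i <= lam / (1 - lam).
Proof.
move=> l01; have /andP[l0 l1] := l01.
have <- : limn (series (geometric lam lam)) = lam / (1 - lam).
  by apply/cvg_lim => //; apply: cvg_geometric_series; rewrite ger0_norm.
apply: lim_series_le.
- exact: is_cvg_coding.
- by apply: is_cvg_geometric_series; rewrite ger0_norm.
- by move=> n; rewrite /= exprS ler_piMl ?mulr_ge0 ?exprn_ge0 ?lern1 ?leq_b1.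
Qed.

Lemma coding_unfold lam i : 0 <= lam < 1 ->
  coding lam i = lam * ((i 0%N)%:R + coding lam (shift_digits 1 i)).
Proof.
move=> l01; have cs := @coding_cvg lam (shift_digits 1 i) l01.
apply: (cvg_unique (@Rhausdorff R) (@coding_cvg lam i l01)).
set U := series _; set l := lam * _.
suff h : [sequence U n.+1]_n @ \oo --> l.
  exact: (eq_ind _ id h _ (cvg_shiftS U (nbhs l))).
have -> : [sequence U n.+1]_n =
    (fun n => lam * ((i 0%N)%:R + series (fun n => (shift_digits 1 i n)%:R * lam ^+ n.+1) n)).
  apply/funext => n; rewrite /U /= /series /= big_nat_recl// mulrDr; congr (_ + _).
    by rewrite expr1 mulrC.
  by rewrite mulr_sumr; apply: eq_bigr => k _; rewrite exprS mulrCA.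
by apply: cvgM; [exact: cvg_cst|apply: cvgD; [exact: cvg_cst|exact: cs]].
Qed.

Lemma coding_shift k lam i j : 0 <= lam < 1 -> (forall l, (l < k)%N -> i l = j l) ->
  coding lam i - coding lam j
  = lam ^+ k * (coding lam (shift_digits k i) - coding lam (shift_digits k j)).
Proof.
move=> l01; elim: k i j => [|k IH] i j ij; first by rewrite mul1r.
rewrite (coding_unfold i)// (coding_unfold j)// (ij 0%N)//.
transitivity (lam * (coding lam (shift_digits 1 i) - coding lam (shift_digits 1 j))); first by ring.
rewrite IH => [|l lk]; last by rewrite /shift_digits !add1n ij.
by rewrite mulrA -exprS.
Qed.

(** After the common prefix is factored out, both tails are codings and lie in
    [0, lam / (1 - lam)]. *)
Lemma coding_agree k lam i j : 0 <= lam < 1 -> (forall l, (l < k)%N -> i l = j l) ->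
  `|coding lam i - coding lam j| <= lam ^+ k * (lam / (1 - lam)).
Proof.
move=> l01 /(coding_shift l01) ->; have /andP[l0 l1] := l01.
rewrite normrM ger0_norm ?exprn_ge0// ler_wpM2l ?exprn_ge0//.
have := coding_ge0 (shift_digits k i) l01; have := coding_ge0 (shift_digits k j) l01.
have := coding_le (shift_digits k i) l01; have := coding_le (shift_digits k j) l01.
by rewrite ler_norml; lra.
Qed.

(** A pointwise limit of measurable partial sums. Parameter and digits may both vary with t, since
    measurability is needed jointly in (lam, q, u). *)
Lemma measurable_coding d (T : measurableType d) (D : set T) (f : T -> R)
    (Y : T -> nat -> bool) :
  measurable D -> measurable_fun D f -> (forall n, measurable_fun D (Y ^~ n)) ->
  (forall t, D t -> 0 <= f t < 1) ->
  measurable_fun D (fun t => coding (f t) (Y t)).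
Proof.
move=> mD mf mY f01.
apply: (measurable_fun_cvg
  (h := fun n t => series (fun n => (Y t n)%:R * f t ^+ n.+1) n)); last first.
  by move=> t Dt; exact/coding_cvg/f01.
move=> n; apply: measurable_sum => k; apply: measurable_funM.
  have -> : (fun t => (Y t k)%:R : R) = (fun t => if Y t k then 1 else 0).
    by apply/funext => t; case: (Y t k).
  apply: measurable_fun_if => //; apply: measurable_cst.
exact: measurable_funX.
Qed.

End coding.

(** * Transversality estimates for a fixed digit sequence *)

Section transversality.
Context (R : realType).
Notation leb := (@lebesgue_measure R).
Implicit Types (lam r : R) (i : nat -> bool).

(** [nth false w] pads the word with zeros, so the word stands for its whole cylinder up to an error
    of order lam^n. *)
Definition hits (K lam x : R) n (w : seq bool) : bool :=
  `|coding lam (nth false w) - x| < K * lam ^+ n.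

(* Bounds the mass of the ball of centre x and radius lam ^+ n by a finite sum:
   K absorbs the tails of the series. *)
Definition hit_mass K r lam x n : R :=
  \sum_(w <- words n) weight r w * (hits K lam x n w)%:R.

Lemma measurable_hits K b i n w : b <= 1 ->
  measurable [set lam : R | 0 < lam < b /\ hits K lam (coding lam i) n w].
Proof.
move=> b1; pose D : set R := `]0, b[%classic.
have D1 lam : D lam -> 0 <= lam < 1.
  by rewrite /D /= in_itv /= => /andP[l0 lb]; rewrite ltW//= (lt_le_trans lb).
have -> : [set lam | 0 < lam < b /\ hits K lam (coding lam i) n w] =
    D `&` (fun lam => hits K lam (coding lam i) n w) @^-1` [set true].
  by rewrite /D; apply/seteqP; split=> lam /=; rewrite in_itv.
have mD : measurable D by exact: measurable_itv.
suff : measurable_fun D (fun lam => hits K lam (coding lam i) n w) by apply.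
apply: measurable_fun_ltr.
  apply: measurableT_comp => //; apply: measurable_funB;
  by apply: measurable_coding => //.
by apply: measurable_funM; [exact: measurable_cst|apply: measurable_funX].
Qed.

Lemma measurable_close b i j e : b <= 1 ->
  measurable [set lam : R | 0 < lam < b /\ `|coding lam i - coding lam j| < e].
Proof.
move=> b1; pose D : set R := `]0, b[%classic.
have D1 lam : D lam -> 0 <= lam < 1.
  by rewrite /D /= in_itv /= => /andP[l0 lb]; rewrite ltW//= (lt_le_trans lb).
have -> : [set lam | 0 < lam < b /\ `|coding lam i - coding lam j| < e] =
    D `&` (fun lam => `|coding lam i - coding lam j| < e) @^-1` [set true].
  by rewrite /D; apply/seteqP; split=> lam /=; rewrite in_itv.
have mD : measurable D by exact: measurable_itv.
suff : measurable_fun D (fun lam => `|coding lam i - coding lam j| < e) by apply.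
apply: measurable_fun_ltr => //.
apply: measurableT_comp => //; apply: measurable_funB;
by apply: measurable_coding => //.
Qed.

(** If w and i first differ at k < n, factoring out lam^k leaves two sequences with distinct first
    digits at distance below K lam^(n - k) < K b^(n - k), and transversality applies. If they agree
    up to n, the bound is b <= 1. Writing the bound as a sum over all common prefixes makes it easy
    to sum over w. *)
Lemma lebesgue_hits (lstar C b K : R) i n w :
  0 < C -> 0 < K -> 0 < b <= lstar -> lstar < 1 ->
  (forall i j : nat -> bool, i 0%N != j 0%N ->
    forall delta : R, 0 < delta ->
      (leb [set lam : R | 0 < lam < lstar
                        /\ `|coding lam i - coding lam j| < delta]%R
       < (C * delta)%:E)%E) ->
  (leb [set lam : R | 0 < lam < b /\ hits K lam (coding lam i) n w]%R
   <= (\sum_(k < n) (C * K * b ^+ (n - k) * (mkseq (nth false w) k == mkseq i k)%:R)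
      + (mkseq (nth false w) n == mkseq i n)%:R)%:E)%E.
Proof.
move=> C0 K0 /andP[b0 bl] l1 tr.
have b1 : b <= 1 by rewrite (le_trans bl)// ltW.
have mH := measurable_hits K i n w b1.
have sum0 : 0 <= \sum_(k < n) (C * K * b ^+ (n - k) * (mkseq (nth false w) k == mkseq i k)%:R).
  by apply: sumr_ge0 => k _; rewrite !mulr_ge0 ?exprn_ge0 ?(ltW C0) ?(ltW K0) ?(ltW b0).
have [wi|wi] := eqVneq (mkseq (nth false w) n) (mkseq i n).
  apply: (@le_trans _ _ (leb `]0, b[%classic)).
    by apply: le_measure; rewrite ?inE// => lam /= []; rewrite in_itv.
  by rewrite lebesgue_measure_itv /= lte_fin b0 -EFinD lee_fin subr0 ler_wpDl.
(* [k] is the length of the longest common prefix of [w] and [i]. *)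
have [k [kn [wik agree]]] : exists k, [/\ (k < n)%N, nth false w k != i k
    & forall l, (l < k)%N -> nth false w l = i l].
  have ex : exists k, (k < n)%N && (nth false w k != i k).
    apply: contrapT => h; move/eqP: wi; apply; apply/eq_in_map => k.
    rewrite mem_iota add0n /= => kn; apply/eqP; apply: contrapT => /negP ne.
    by apply: h; exists k; rewrite kn.
  case: (ex_minnP ex) => k /andP[kn wik] kmin.
  exists k; split => // l lk; apply/eqP; apply: contrapT => /negP ne.
  have : (l < n)%N && (nth false w l != i l) by rewrite (ltn_trans lk).
  by move=> /kmin; rewrite leqNgt lk.
have agree_mk : mkseq (nth false w) k == mkseq i k.
  by apply/eqP/eq_in_map => l; rewrite mem_iota add0n => /= /agree.
have d0 : 0 < K * b ^+ (n - k) by rewrite mulr_gt0 ?exprn_gt0.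
have := tr (shift_digits k (nth false w)) (shift_digits k i); rewrite /shift_digits addn0.
move=> /(_ wik _ d0) /ltW le1.
rewrite addr0; apply: le_trans (_ : _ <= (C * (K * b ^+ (n - k)))%:E)%E _.
  apply: le_trans le1; apply: le_measure; rewrite ?inE//.
    by apply: measurable_close; exact: ltW.
  move=> lam [/andP[l0 lb]]; rewrite /hits (coding_shift _ agree); last first.
    by rewrite ltW//= (lt_le_trans lb).
  rewrite normrM ger0_norm ?exprn_ge0 ?(ltW l0)// => hlt.
  split; first by rewrite l0 (lt_le_trans lb).
  have hh : `|coding lam (shift_digits k (nth false w)) - coding lam (shift_digits k i)|
     < K * lam ^+ (n - k).
    rewrite -(@ltr_pM2l _ (lam ^+ k)) ?exprn_gt0//; apply: lt_le_trans hlt _.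
    by rewrite mulrCA -exprD subnKC// ltnW.
  apply: lt_le_trans hh _; rewrite ler_pM2l// lerXn2r ?nnegrE ?ltW//.
(* The term of index [k] alone suffices; the others are nonnegative. *)
rewrite lee_fin (bigD1 (Ordinal kn))//= agree_mk mulr1 mulrA lerDl.
by apply: sumr_ge0 => l _; rewrite !mulr_ge0 ?exprn_ge0 ?(ltW C0) ?(ltW K0) ?(ltW b0).
Qed.

(** Exchange the sums over w and k; by [sum_weight_prefix] the words sharing k letters with i have
    total weight that of the prefix of i. *)
Lemma sum_lebesgue_hits (lstar C b K r : R) i n :
  0 < C -> 0 < K -> 0 < b <= lstar -> lstar < 1 -> 0 <= r <= 1 ->
  (forall i j : nat -> bool, i 0%N != j 0%N ->
    forall delta : R, 0 < delta ->
      (leb [set lam : R | 0 < lam < lstar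
                        /\ `|coding lam i - coding lam j| < delta]%R
       < (C * delta)%:E)%E) ->
  (\sum_(w <- words n) (weight r w)%:E *
     leb [set lam : R | 0 < lam < b /\ hits K lam (coding lam i) n w]%R
   <= (\sum_(k < n) (C * K * b ^+ (n - k) * weight r (mkseq i k))
      + weight r (mkseq i n))%:E)%E.
Proof.
move=> C0 K0 b0 l1 r01 tr.
pose g w := \sum_(k < n) (C * K * b ^+ (n - k) * (mkseq (nth false w) k == mkseq i k)%:R)
      + (mkseq (nth false w) n == mkseq i n)%:R.
apply: (@le_trans _ _ (\sum_(w <- words n) (weight r w * g w)%:E)%E).
  apply: lee_sum => w _; rewrite EFinM; apply: lee_wpmul2l.
    by rewrite lee_fin weight_ge0.
  exact: lebesgue_hits tr.
rewrite sumEFin lee_fin le_eqVlt; apply/orP; left; apply/eqP.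
transitivity (\sum_(w <- words n) (\sum_(k < n) C * K * b ^+ (n - k) *
     (weight r w * (mkseq (nth false w) k == mkseq i k)%:R)
   + weight r w * (mkseq (nth false w) n == mkseq i n)%:R)).
  apply: eq_bigr => w _; rewrite /g mulrDr mulr_sumr; congr (_ + _).
  by apply: eq_bigr => k _; ring.
rewrite big_split /= sum_weight_prefix// exchange_big /=; congr (_ + _).
by apply: eq_bigr => k _; rewrite -mulr_sumr sum_weight_prefix// ltnW.
Qed.

(** With prefix weights at most A c1^k, the sum of b^(n - k) c1^k is geometric of ratio b / c1 < 1,
    hence O(c1^n). Dividing by c2^n leaves the summable factor (c1 / c2)^n that [ae_bounded_step]
    requires. *)
Lemma ae_hit_mass_bounded (lstar b c1 c2 K r A : R) i :
  transversality lstar -> 0 < K -> 0 < b <= lstar -> lstar < 1 -> 0 < r < 1 ->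
  b < c1 < c2 -> (forall n, weight r (mkseq i n) <= A * c1 ^+ n) ->
  {ae leb, forall lam, 0 < lam < b ->
     exists M, forall n, hit_mass K r lam (coding lam i) n <= M * c2 ^+ n}.
Proof.
move=> [C C0 tr] K0 b0l l1 r01 /andP[bc1 c12] hA.
have /andP[b0 bl] := b0l.
have c10 : 0 < c1 by exact: lt_trans bc1.
have c20 : 0 < c2 by exact: lt_trans c12.
have r01' : 0 <= r <= 1 by case/andP: r01 => ? ?; rewrite !ltW.
have A0 : 0 <= A.
  have := hA 0%N; rewrite expr0 mulr1; apply: le_trans; exact: weight_ge0.
have bc : b / c1 < 1 by rewrite ltr_pdivrMr// mul1r.
(* The geometric series bounds the terms k < n; the added 1 accounts for the full prefix of length
   n. *)
pose S := C * K / (1 - b / c1) + 1.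
have E1 n : (\sum_(k < n) (C * K * b ^+ (n - k) * weight r (mkseq i k))
      + weight r (mkseq i n)) <= A * S * c1 ^+ n.
  have s1 : \sum_(k < n) (C * K * b ^+ (n - k) * weight r (mkseq i k))
      <= A * (C * K / (1 - b / c1)) * c1 ^+ n.
    apply: (@le_trans _ _ (\sum_(k < n) A * (C * K) * c1 ^+ n * (b / c1) ^+ (n - k))).
      apply: ler_sum => k _.
      have -> : A * (C * K) * c1 ^+ n * (b / c1) ^+ (n - k)
          = C * K * b ^+ (n - k) * (A * c1 ^+ k).
        have -> : c1 ^+ n = c1 ^+ k * c1 ^+ (n - k) by rewrite -exprD subnKC// ltnW.
        by rewrite expr_div_n; field; rewrite expf_neq0// gt_eqF.
      by rewrite ler_wpM2l// !mulr_ge0 ?exprn_ge0 ?(ltW C0) ?(ltW K0) ?(ltW b0).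
    rewrite -mulr_sumr.
    have -> : A * (C * K / (1 - b / c1)) * c1 ^+ n
       = A * (C * K) * c1 ^+ n * (1 / (1 - b / c1)) by rewrite mul1r; ring.
    apply: ler_wpM2l.
      by rewrite !mulr_ge0 ?exprn_ge0 ?(ltW C0) ?(ltW K0) ?(ltW c10).
    have bc0 : 0 < b / c1 by rewrite divr_gt0.
    rewrite ler_pdivlMr ?subr_gt0//.
    apply: (@le_trans _ _ ((\sum_(k < n) (b / c1) ^+ k) * (1 - b / c1))).
      rewrite ler_wpM2r ?subr_ge0 ?(ltW bc)//.
      (* Reversal turns the exponent n - k into k + 1, and one factor b / c1 < 1 is dropped. *)
      rewrite (reindex_inj rev_ord_inj) /=; apply: ler_sum => k _.
      rewrite subnBA// addnC -addnBA// subnn addn0 exprS ger_pMl ?exprn_gt0//.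
      exact: ltW.
    by rewrite mulrC -opprB mulNr -subrX1 opprB gerBl exprn_ge0// ltW.
  have -> : A * S * c1 ^+ n = A * (C * K / (1 - b / c1)) * c1 ^+ n + A * c1 ^+ n.
    by rewrite /S; ring.
  exact: lerD.
have rho01 : 0 <= c1 / c2 < 1.
  by rewrite divr_ge0 ?(ltW c10) ?(ltW c20)//= ltr_pdivrMr// mul1r.
have mE n w : measurable [set lam : R | 0 < lam < b /\ hits K lam (coding lam i) n w].
  by apply: measurable_hits; rewrite (le_trans bl)// ltW.
have a0 n w : 0 <= weight r w * c2 ^- n.
  by rewrite mulr_ge0 ?invr_ge0 ?exprn_ge0 ?weight_ge0// ltW.
have hB n : (\sum_(w <- words n) (weight r w * c2 ^- n)%:E *
     leb [set lam : R | 0 < lam < b /\ hits K lam (coding lam i) n w]%R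
     <= (A * S * (c1 / c2) ^+ n)%:E)%E.
  under eq_bigr do rewrite [(weight _ _ * _)%R]mulrC EFinM -muleA.
  rewrite -ge0_sume_distrr; last by move=> w _; rewrite mule_ge0// lee_fin weight_ge0.
  apply: (@le_trans _ _ ((c2 ^- n)%:E * (A * S * c1 ^+ n)%:E)%E).
    apply: lee_wpmul2l; first by rewrite lee_fin invr_ge0 exprn_ge0// ltW.
    by apply: le_trans (sum_lebesgue_hits _ _ C0 K0 b0l l1 r01' tr) _; rewrite lee_fin.
  by rewrite -EFinM lee_fin expr_div_n mulrC mulrA.
have := @ae_bounded_step _ _ R leb _ words (fun n w => weight r w * c2 ^- n) _ (A * S)
  (c1 / c2) a0 mE rho01 hB.
apply: filterS => lam [M hM] lb; exists M => n.
rewrite -ler_pdivrMr ?exprn_gt0//; apply: le_trans (hM n).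
rewrite /hit_mass mulr_suml le_eqVlt; apply/orP; left; apply/eqP.
apply: eq_bigr => w _; rewrite mulrAC; congr (_ * _).
rewrite indicE; congr (_ %:R); congr nat_of_bool.
by apply/idP/idP => [h|]; rewrite inE /=; [split|case].
Qed.

End transversality.

(** * Null sections by Tonelli's theorem *)

Section null_sections.
Context d1 d2 (T1 : measurableType d1) (T2 : measurableType d2) (R : realType).
Context (m1 : {sigma_finite_measure set T1 -> \bar R})
        (m2 : {sigma_finite_measure set T2 -> \bar R}).

(** Both iterated integrals of the indicator agree and one of them is 0; a nonnegative function with
    zero integral vanishes almost everywhere. *)
Lemma ae_null_xsection (B : set (T1 * T2)) : measurable B ->
  (forall y, m1 (ysection B y) = 0%E) ->
  {ae m1, forall x, m2 (xsection B x) = 0%E}.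
Proof.
move=> mB B0.
have mF := measurable_fun_xsection m2 mB.
have I0 : (\int[m1]_x `|(m2 \o xsection B) x| = 0)%E.
  under eq_integral do rewrite gee0_abs//.
  have := indic_fubini_tonelli m1 m2 mB.
  rewrite (indic_fubini_tonelli_FE m2 mB) (indic_fubini_tonelli_GE m1 mB) => ->.
  by under eq_integral do rewrite /= B0; rewrite integral0.
have /(_ I0) := (ae_eq_integral_abs m1 measurableT mF).1.
by apply: filterS => x /(_ Logic.I).
Qed.

End null_sections.

(** * The exceptional parameters and their nullity *)

Section exceptional_set.
Context (R : realType).
Notation leb := (@lebesgue_measure R).

Lemma measurable_digit_state d (T : measurableType d) (qf uf : T -> R) n :
  measurable_fun setT qf -> measurable_fun setT uf ->
  measurable_fun setT (fun t => (digit_state (qf t) (uf t) n).1) /\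
  measurable_fun setT (fun t => (digit_state (qf t) (uf t) n).2).
Proof.
move=> mq mu; elim: n => [|n [IH1 IH2]] /=; first by split; exact: measurable_cst.
have m1 : measurable_fun setT
   (fun t => (digit_state (qf t) (uf t) n).1 + qf t * (digit_state (qf t) (uf t) n).2).
  by apply: measurable_funD => //; exact: measurable_funM.
have mb := measurable_fun_ler m1 mu.
split.
  rewrite (_ : (fun t => _) = fun t : T =>
    if (digit_state (qf t) (uf t) n).1 + qf t * (digit_state (qf t) (uf t) n).2 <= uf t
    then (digit_state (qf t) (uf t) n).1 + qf t * (digit_state (qf t) (uf t) n).2
    else (digit_state (qf t) (uf t) n).1).
    exact: measurable_fun_ifT.
  by apply/funext => t; rewrite /refine; case: ifP.
rewrite (_ : (fun t => _) = fun t : T =>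
    if (digit_state (qf t) (uf t) n).1 + qf t * (digit_state (qf t) (uf t) n).2 <= uf t
    then (1 - qf t) * (digit_state (qf t) (uf t) n).2 : R
    else qf t * (digit_state (qf t) (uf t) n).2).
  apply: measurable_fun_ifT => //; apply: measurable_funM => //.
  by apply: measurable_funB => //; exact: measurable_cst.
by apply/funext => t; rewrite /refine; case: ifP.
Qed.

Lemma measurable_digit d (T : measurableType d) (qf uf : T -> R) n :
  measurable_fun setT qf -> measurable_fun setT uf ->
  measurable_fun setT (fun t => digit (qf t) (uf t) n).
Proof.
move=> mq mu; have [m1 m2] := measurable_digit_state n mq mu.
apply: measurable_fun_ler => //; apply: measurable_funD => //.
exact: measurable_funM.
Qed.

Lemma measurable_bias d (T : measurableType d) (rf : T -> R) (Y : T -> bool) :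
  measurable_fun setT rf -> measurable_fun setT Y ->
  measurable_fun setT (fun t => bias (rf t) (Y t)).
Proof.
move=> mr mY; apply: measurable_fun_ifT => //.
by apply: measurable_funB => //; exact: measurable_cst.
Qed.

(** The constant is a natural number so that the set is a countable union of countable
    intersections. *)
Lemma measurable_geo_bounded d (T : measurableType d) (D : set T) (f : nat -> T -> R) c :
  measurable D -> (forall n, measurable_fun D (f n)) ->
  measurable (D `&` [set t | exists A : nat, forall n, f n t <= A%:R * c ^+ n]).
Proof.
move=> mD mf.
have -> : D `&` [set t | exists A : nat, forall n, f n t <= A%:R * c ^+ n]
   = \bigcup_A \bigcap_n (D `&` [set t | f n t <= A%:R * c ^+ n]).
  apply/seteqP; split=> [t [Dt [A h]]|t [A _ h]].
    by exists A => // n _; split => //=; exact: h.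
  by split; [exact: (h 0%N _).1|exists A => n; exact: (h n _).2].
apply: bigcup_measurable => A _; apply: bigcap_measurable => // n _.
have h : measurable_fun D (fun t => f n t <= A%:R * c ^+ n).
  by apply: measurable_fun_ler => //; exact: measurable_cst.
have := h mD [set true] I.
by congr (measurable (_ `&` _)); apply/seteqP; split=> t.
Qed.

(* The growth condition on the weights is part of the set, so that every section
   at fixed (q, u) is null, and not only almost every one. *)
Definition exceptional (K b c1 c2 : R) (pf : R -> R) : set ((R * R) * R) :=
  [set t | [/\ 0 < t.1.1 < b, 0 < t.1.2 < 1,
     exists A : nat, forall n,
       weight (pf t.1.2) (mkseq (digit t.1.2 t.2) n) <= A%:R * c1 ^+ n &
     ~ exists M : nat, forall n,
       hit_mass K (pf t.1.2) t.1.1 (coding t.1.1 (digit t.1.2 t.2)) n <= M%:R * c2 ^+ n]].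

Lemma measurable_exceptional K b c1 c2 pf : b <= 1 -> measurable_fun setT pf ->
  measurable (exceptional K b c1 c2 pf).
Proof.
move=> b1 mpf.
pose T := ((R * R) * R)%type.
have ml : measurable_fun setT (fun t : T => t.1.1).
  exact: (measurableT_comp measurable_fst measurable_fst).
have mq : measurable_fun setT (fun t : T => t.1.2).
  exact: (measurableT_comp measurable_snd measurable_fst).
have mu : measurable_fun setT (fun t : T => t.2) by exact: measurable_snd.
have mr : measurable_fun setT (fun t : T => pf t.1.2) by exact: measurableT_comp.
have md n := measurable_digit n mq mu.
pose D : set T := ((fun t => t.1.1) @^-1` `]0, b[) `&` ((fun t => t.1.2) @^-1` `]0, 1[).
have mD : measurable D.
  by apply: measurableI; rewrite -[X in measurable X]setTI;
    [apply: ml|apply: mq] => //; exact: measurable_itv.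
have Dlt t : D t -> 0 <= t.1.1 < 1.
  by rewrite /D /= !in_itv /= => -[/andP[l0 lb] _]; rewrite ltW//= (lt_le_trans lb).
pose f n (t : T) := weight (pf t.1.2) (mkseq (digit t.1.2 t.2) n).
pose g n (t : T) :=
  hit_mass K (pf t.1.2) t.1.1 (coding t.1.1 (digit t.1.2 t.2)) n.
have mw w : measurable_fun setT (fun t : T => weight (pf t.1.2) w).
  apply: measurable_prod => x _.
  by apply: (@measurable_bias _ _ (fun t : T => pf t.1.2) (fun=> x)) => //; exact: measurable_cst.
have mf n : measurable_fun D (f n).
  apply: measurable_funTS; rewrite /f /weight.
  under eq_fun do rewrite big_map.
  by apply: measurable_prod => k _; exact: measurable_bias.
have mg n : measurable_fun D (g n).
  apply: measurable_sum => w; apply: measurable_funM; first exact: measurable_funTS.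
  have mh : measurable_fun D (fun t : T =>
      hits K t.1.1 (coding t.1.1 (digit t.1.2 t.2)) n w).
    apply: measurable_fun_ltr.
      apply: measurableT_comp => //; apply: measurable_funB;
      apply: measurable_coding => //; try exact: measurable_funTS.
      by move=> k; apply: measurable_funTS; exact: md.
    apply: measurable_funM; first exact: measurable_cst.
    by apply: measurable_funX; exact: measurable_funTS.
  rewrite (_ : (fun t => _) = fun t : T =>
      if hits K t.1.1 (coding t.1.1 (digit t.1.2 t.2)) n w then 1 else 0).
    by apply: measurable_fun_if => //; exact: measurable_cst.
  by apply/funext => t; case: (hits _ _ _ _ _).
(* The exceptional set is the difference of two growth sets inside [D]: that of the weights minus
   that of the hit masses. *)
have := measurableD (measurable_geo_bounded c1 mD mf) (measurable_geo_bounded c2 mD mg).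
congr measurable; apply/seteqP; split=> t.
  rewrite /D /= !in_itv /= => -[[[tl tq] h1] h2]; split => // h3; apply: h2.
  by split.
rewrite /exceptional /D /= !in_itv /= => -[tl tq h1 h2]; split; first by split.
by move=> [_ h3]; exact: h2.
Qed.

(** At fixed (q, u) the section in lam is null by [ae_hit_mass_bounded]. Tonelli is then used twice
    to move the quantifier on lam to the front: in (lam, u) at fixed q, and in (lam, q). *)
Lemma exceptional_null (lstar K b c1 c2 : R) (pf : R -> R) :
  transversality lstar -> 0 < K -> 0 < b <= lstar -> lstar < 1 ->
  measurable_fun setT pf -> (forall q, 0 < q < 1 -> 0 < pf q < 1) ->
  b < c1 < c2 ->
  {ae leb, forall lam, {ae leb, forall q, {ae leb, forall u,
     ~ exceptional K b c1 c2 pf ((lam, q), u)}}}.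
Proof.
move=> tr K0 b0l l1 mpf pf01 c12.
have b1 : b <= 1 by case/andP: b0l => _ bl; rewrite (le_trans bl)// ltW.
have mB := measurable_exceptional K c1 c2 b1 mpf.
set B := exceptional _ _ _ _ _ in mB *.
have lam0 q u : leb [set lam | B ((lam, q), u)] = 0%E.
  have mS : measurable [set lam | B ((lam, q), u)].
    rewrite -[X in measurable X]setTI.
    apply: (_ : measurable_fun setT (fun lam => ((lam, q), u))) => //.
    apply: measurable_fun_pair; last exact: measurable_cst.
    by apply: measurable_fun_pair; [exact: measurable_id|exact: measurable_cst].
  apply/negligibleP => //.
  have [q01|nq] := boolP (0 < q < 1); last first.
    by apply: negligibleS (negligible_set0 _) => lam [_ /= q01]; rewrite q01 in nq.
  have [[A hA]|nA] := pselect (exists A : nat, forall n,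
       weight (pf q) (mkseq (digit q u) n) <= A%:R * c1 ^+ n); last first.
    by apply: negligibleS (negligible_set0 _) => lam [_ _ /=].
  have := ae_hit_mass_bounded tr K0 b0l l1 (pf01 _ q01) c12 hA.
  apply: negligibleS => lam [/= lb _ _ nM] /(_ lb)[M hM]; apply: nM.
  exists (Num.truncn `|M|).+1 => n; apply: le_trans (hM n) _.
  apply: ler_wpM2r.
    case/andP: b0l c12 => b0 _ /andP[bc1 c12].
    by rewrite exprn_ge0// ltW// (lt_trans b0)// (lt_trans bc1).
  by apply: (le_trans (ler_norm _)); rewrite ltW// truncnS_gt.
have mX : measurable_fun setT (leb \o xsection B) := measurable_fun_xsection leb mB.
(* The pairs (lam, q) whose section in u is not null. *)
pose B2 : set (R * R) := [set x | leb (xsection B x) != 0%E].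
have mB2 : measurable B2.
  rewrite (_ : B2 = (leb \o xsection B) @^-1` (~` [set 0%E])).
    by rewrite -[X in measurable X]setTI; apply: mX => //; exact: measurableC.
  by apply/seteqP; split=> x /= => [/eqP|h]; [|exact/eqP].
have Bq q : leb (ysection B2 q) = 0%E.
  have mBq : measurable [set z : R * R | B ((z.1, q), z.2)].
    rewrite -[X in measurable X]setTI.
    apply: (_ : measurable_fun setT (fun z : R * R => ((z.1, q), z.2))) => //.
    apply: measurable_fun_pair; last exact: measurable_snd.
    by apply: measurable_fun_pair; [exact: measurable_fst|exact: measurable_cst].
  apply/negligibleP; first exact: measurable_ysection.
  have yB u : leb (ysection [set z : R * R | B ((z.1, q), z.2)] u) = 0%E.
    rewrite -[RHS](lam0 q u); congr (leb _).
    by apply/seteqP; split=> lam; rewrite /ysection /= inE.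
  have := @ae_null_xsection _ _ _ _ R leb leb _ mBq yB.
  apply: negligibleS => lam; rewrite /ysection /= inE /B2 /=.
  move=> /eqP h1 h2; apply: h1; rewrite -[RHS]h2; congr (leb _).
have := @ae_null_xsection _ _ _ _ R leb leb B2 mB2 Bq.
apply: filterS => lam /(negligibleP leb (measurable_xsection lam mB2)).2.
apply: negligibleS => q; rewrite /xsection /= inE /B2 /=.
apply: contra_notN => /eqP /(negligibleP leb (measurable_xsection (lam, q) mB)).2.
by apply: negligibleS => u /=; rewrite /xsection /= inE => /contrapT.
Qed.

End exceptional_set.

(** * Local dimension from geometric scales *)

Section local_dimension.
Context (R : realType).
Implicit Types lam r c : R.

Lemma ln_exprn r n : 0 < r -> ln (r ^+ n) = n%:R * ln r.
Proof. by move=> r0; rewrite lnXn// mulr_natl. Qed.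

Lemma power_bracket lam r : 0 < lam < 1 -> 0 < r < 1 ->
  exists n, lam ^+ n.+1 <= r <= lam ^+ n.
Proof.
move=> /andP[l0 l1] /andP[r0 r1].
have lnl : ln lam < 0 by rewrite ln_lt0// l0.
have lnr : ln r < 0 by rewrite ln_lt0// r0.
have q0 : 0 <= ln r / ln lam by rewrite ltW// nmulr_rgt0// invr_lt0.
have /andP[h1 h2] := Num.Theory.truncn_itv q0.
exists (Num.truncn (ln r / ln lam)).
rewrite -[lam ^+ _ <= r]ler_ln ?posrE ?exprn_gt0//.
rewrite -[r <= _]ler_ln ?posrE ?exprn_gt0// !ln_exprn//; apply/andP; split.
  by rewrite -ler_ndivrMr// ltW.
by rewrite -ler_ndivlMr.
Qed.

(** The hypotheses pin f (lam^n) between powers with bases arbitrarily close to lam^alpha.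
    Monotonicity extends this to every r between lam^(n + 1) and lam^n, and the bounded error
    disappears after division by ln r. Positivity is kept in the conclusion for the passage to the
    extended-real logarithm. *)
Lemma local_dim_cvg (f : R -> R) lam alpha : 0 < lam < 1 ->
  (forall r r', r <= r' -> f r <= f r') ->
  (forall c, expR (alpha * ln lam) < c ->
     exists M, forall n, f (lam ^+ n) <= M * c ^+ n) ->
  (forall c, 0 < c < expR (alpha * ln lam) ->
     exists2 A, 0 < A & forall n, A * c ^+ n <= f (lam ^+ n)) ->
  (forall r, 0 < r < 1 -> 0 < f r) /\
  ln (f r) / ln r @[r --> (0 : R)^'+] --> alpha.
Proof.
move=> l01 fmono hup hlow.
have /andP[l0 l1] := l01.
have lnl : ln lam < 0 by rewrite ln_lt0// l0.
have fpos r : 0 < r < 1 -> 0 < f r.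
  move=> r01; have [n /andP[nr _]] := power_bracket l01 r01.
  have [|A A0 hA] := hlow (expR ((alpha + 1) * ln lam)).
    by rewrite expR_gt0 ltr_expR mulrDl mul1r gtrDl.
  apply: (lt_le_trans _ (fmono _ _ nr)); apply: lt_le_trans (hA _).
  by rewrite mulr_gt0// exprn_gt0// expR_gt0.
split => //; apply/cvgrPdist_le => e e0.
pose L := - ln lam; have L0 : 0 < L by rewrite oppr_gt0.
have [|M hM] := hup (expR ((alpha - e / 2) * ln lam)).
  by rewrite ltr_expR mulrBl ltrBDr gtrDl nmulr_llt0// divr_gt0.
have [|A A0 hA] := hlow (expR ((alpha + e / 2) * ln lam)).
  by rewrite expR_gt0 ltr_expR mulrDl gtrDl nmulr_llt0// divr_gt0.
have M0 : 0 < M.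
  have l2 : 0 < lam ^+ 1 < 1 by rewrite expr1.
  have := lt_le_trans (fpos _ l2) (hM 1%N).
  by rewrite pmulr_lgt0// exprn_gt0// expR_gt0.
(* Once -ln r exceeds [C], the logarithms of the two constants and the bracketing error together
   stay below (e / 2) (-ln r); the other e / 2 comes from the bases. *)
pose C := (`|ln M| + `|ln A| + (`|alpha| + e) * L) * (2 / e).
have r1E : (0 : R) < Num.min (expR (- C)) 1 by rewrite lt_min expR_gt0 ltr01.
near=> r.
have r0 : 0 < r by near: r; exact: nbhs_right_gt.
have : r < Num.min (expR (- C)) 1 by near: r; exact: nbhs_right_lt.
rewrite lt_min => /andP[rC r1].
have r01 : 0 < r < 1 by rewrite r0.
have [n /andP[nr rn]] := power_bracket l01 r01.
pose rho := - ln r.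
have rhoC : C < rho.
  suff h : ln r < - C by rewrite /rho ltrNr.
  by rewrite -(expRK (- C)) ltr_ln// posrE// expR_gt0.
have lnr : ln r < 0 by rewrite ln_lt0.
have lnX k : ln (lam ^+ k) = - (k%:R * L).
  by rewrite ln_exprn// /L mulrN opprK.
have n1 : n%:R * L <= rho.
  by rewrite lerNr -lnX ler_ln ?posrE ?exprn_gt0.
have n2 : rho <= n.+1%:R * L.
  by rewrite lerNl -lnX ler_ln ?posrE ?exprn_gt0.
have fr0 := fpos r r01.
have up : ln (f r) <= ln M - n%:R * ((alpha - e / 2) * L).
  have : f r <= M * expR ((alpha - e / 2) * ln lam) ^+ n.
    exact: le_trans (fmono _ _ rn) (hM n).
  rewrite -ler_ln ?posrE ?mulr_gt0 ?exprn_gt0 ?expR_gt0//.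
  rewrite lnM ?posrE ?exprn_gt0 ?expR_gt0// ln_exprn ?expR_gt0// expRK => h.
  by apply: le_trans h _; rewrite /L; lra.
have low : ln A - n.+1%:R * ((alpha + e / 2) * L) <= ln (f r).
  have : A * expR ((alpha + e / 2) * ln lam) ^+ n.+1 <= f r.
    exact: le_trans (hA n.+1) (fmono _ _ nr).
  rewrite -ler_ln ?posrE ?mulr_gt0 ?exprn_gt0 ?expR_gt0//.
  rewrite lnM ?posrE ?exprn_gt0 ?expR_gt0// ln_exprn ?expR_gt0// expRK => h.
  by apply: le_trans _ h; rewrite /L; lra.
have lnM_le := ler_norm (ln M).
have lnA_ge : - `|ln A| <= ln A by rewrite lerNl -normrN ler_norm.
have CE : C * (e / 2) = `|ln M| + `|ln A| + (`|alpha| + e) * L.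
  by rewrite /C; field; rewrite gt_eqF.
have Ce : C * (e / 2) < rho * (e / 2) by rewrite ltr_pM2r// divr_gt0.
rewrite -natr1 in n2 low.
have b1 : `|n%:R * L - rho| <= L by rewrite ler_norml; lra.
have b2 : `|(n%:R + 1) * L - rho| <= L by rewrite ler_norml; lra.
have a1 : `|alpha - e / 2| <= `|alpha| + e.
  by apply: (le_trans (ler_normB _ _)); rewrite lerD2l ger0_norm ?divr_ge0 ?(ltW e0)//; lra.
have a2 : `|alpha + e / 2| <= `|alpha| + e.
  by apply: (le_trans (ler_normD _ _)); rewrite lerD2l ger0_norm ?divr_ge0 ?(ltW e0)//; lra.
have p1 : `|(alpha - e / 2) * (n%:R * L - rho)| <= (`|alpha| + e) * L.
  by rewrite normrM ler_pM.
have p2 : `|(alpha + e / 2) * ((n%:R + 1) * L - rho)| <= (`|alpha| + e) * L.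
  by rewrite normrM ler_pM.
rewrite !ler_norml in p1 p2.
have hU : ln (f r) <= - (alpha - e) * rho by have := normr_ge0 (ln A); lra.
have hL : - (alpha + e) * rho <= ln (f r) by have := normr_ge0 (ln M); lra.
have -> : alpha - ln (f r) / ln r = alpha + ln (f r) / rho.
  by rewrite /rho invrN mulrN.
have rho0 : 0 < rho by rewrite oppr_gt0.
rewrite ler_norml; apply/andP; split.
  rewrite -lerBlDl -opprD [e + alpha]addrC ler_pdivlMr//.
rewrite -lerBrDl ler_pdivrMr// (le_trans hU)// ler_pM2r//; lra.
Unshelve. all: by end_near. Qed.

End local_dimension.

(** * Covering balls by cylinders of words *)

Section covering_by_words.
Context (R : realType).
Implicit Types (lam x K r : R) (i : nat -> bool).

(** Truncating i at n costs at most lam^n lam / (1 - lam), and x is within lam^n of the coding of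
    i. *)
Lemma hits_near K lam x n i : 0 < lam < 1 -> 1 + lam / (1 - lam) < K ->
  `|coding lam i - x| <= lam ^+ n -> hits K lam x n (mkseq i n).
Proof.
move=> /andP[l0 l1] hK hx; rewrite /hits.
have l01 : 0 <= lam < 1 by rewrite ltW.
have agree l : (l < n)%N -> nth false (mkseq i n) l = i l by move=> ln; rewrite nth_mkseq.
have h := coding_agree l01 agree.
rewrite -(subrKA (coding lam i)); apply: le_lt_trans (ler_normD _ _) _.
apply: le_lt_trans (lerD h hx) _.
by rewrite -[X in _ + X]mulr1 -mulrDr addrC mulrC ltr_pM2r// exprn_gt0// addrC.
Qed.

Lemma measure_bigsetU_seq_le d (T : measurableType d) (mu : {measure set T -> \bar R})
    (I : Type) (s : seq I) (Q : pred I) (E : I -> set T) :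
  (forall j, measurable (E j)) ->
  (mu (\big[setU/set0]_(j <- s | Q j) E j) <= \sum_(j <- s | Q j) mu (E j))%E.
Proof.
move=> mE; elim: s => [|j s IH]; first by rewrite !big_nil measure0.
rewrite !big_cons; case: ifP => // _.
apply: le_trans (measureU2 _ _ _) _ => //; first exact: bigsetU_measurable.
exact: leeD2l.
Qed.

(** The cylinders [E] are abstract: they will be events in [Omega] for the Bernoulli convolution and
    subintervals of [0, 1[ for the digits. *)
Lemma measure_hits_le d (T : measurableType d) (mu : {measure set T -> \bar R})
    (E : seq bool -> set T) K r lam x n :
  (forall w, measurable (E w)) -> (forall w, mu (E w) = (weight r w)%:E) ->
  (mu (\big[setU/set0]_(w <- words n | hits K lam x n w) E w)
    <= (hit_mass K r lam x n)%:E)%E.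
Proof.
move=> mE muE; apply: le_trans (measure_bigsetU_seq_le _ _ _ mE) _.
rewrite /hit_mass -sumEFin big_mkcond /=; apply: lee_sum => w _.
by case: ifP => _; rewrite ?mulr1 ?muE// mulr0.
Qed.

Lemma mem_hits (T : Type) (E : seq bool -> set T) K lam x n w t :
  size w = n -> hits K lam x n w -> E w t ->
  (\big[setU/set0]_(w <- words n | hits K lam x n w) E w) t.
Proof.
move=> sw hw Ewt; rewrite -bigcup_seq_cond; exists w => //=.
by rewrite mem_words sw eqxx.
Qed.

End covering_by_words.

(** * Ball masses and local dimension of the Bernoulli convolution *)

Section bernoulli_local_dim.
Context (R : realType) (d : measure_display) (Omega : measurableType d)
  (P : probability Omega R) (X : nat -> {RV P >-> bool}) (p : R).
Context (hX : biased_iid_digits p X).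

Let cyl w := [set t | mkseq (X ^~ t) (size w) = w].

Let cylE w : cyl w =
  \bigcap_(k in [set` [fset k | k in iota 0 (size w)]%fset]) (X k @^-1` [set nth false w k]).
Proof.
apply/seteqP; split=> t /=.
  move=> e k /=; rewrite !inE /= mem_iota add0n => /= kn.
  by rewrite -[in RHS]e nth_mkseq.
move=> h; apply: (@eq_from_nth _ false); rewrite size_mkseq// => k kn.
by rewrite nth_mkseq//; apply: h; rewrite /= !inE mem_iota.
Qed.

Let measurable_cyl w : measurable (cyl w).
Proof.
rewrite cylE; apply: fin_bigcap_measurable => // k _.
by rewrite -[X in measurable X]setTI; exact: measurable_funPT.
Qed.

Let P_cyl w : P (cyl w) = (weight p w)%:E.
Proof.
have [indep hp] := hX.
rewrite cylE (indep _ (fun k => [set nth false w k]))//.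
rewrite (weightE p (erefl (size w))) -prodEFin.
rewrite -(big_mkord xpredT (fun k => (bias p (nth false w k))%:E)) /index_iota subn0.
rewrite (perm_big (iota 0 (size w))) /=; last first.
  by apply: uniq_perm; [exact: fset_uniq|exact: iota_uniq|move=> k; rewrite !inE].
by apply: eq_bigr => k _; case: (nth false w k); [rewrite (hp k).2|rewrite (hp k).1].
Qed.

Context (lam : R) (l01 : 0 < lam < 1).

Let mcoding : measurable_fun setT (fun t => coding lam (X ^~ t)).
Proof.
apply: measurable_coding => // t _.
by case/andP: l01 => l0 ->; rewrite ltW.
Qed.

Let measurable_close_to x r :
  measurable ((fun t => coding lam (X ^~ t)) @^-1` ball x r).
Proof. by rewrite -[X in measurable X]setTI; apply: mcoding => //; exact: measurable_ball. Qed.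

Lemma bernoulli_ball_le K x n : 1 + lam / (1 - lam) < K ->
  (bernoulli_convolution lam X (ball x (lam ^+ n)) <= (hit_mass K p lam x n)%:E)%E.
Proof.
move=> hK; apply: le_trans (measure_hits_le K lam x n measurable_cyl P_cyl).
rewrite /bernoulli_convolution /pushforward.
apply: le_measure; rewrite ?inE; [exact: measurable_close_to| |].
  by apply: bigsetU_measurable => w _; exact: measurable_cyl.
move=> t /= /ltW; rewrite distrC => xt.
have h := hits_near l01 hK xt.
apply: (mem_hits _ h); first by rewrite size_mkseq.
by rewrite /cyl /= size_mkseq.
Qed.

(** Outcomes that share n digits with i are coded within lam^n lam / (1 - lam) < K lam^n of it,
    hence inside the ball. *)
Lemma bernoulli_ball_ge K i n r : 1 + lam / (1 - lam) < K -> K * lam ^+ n <= r ->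
  ((weight p (mkseq i n))%:E <= bernoulli_convolution lam X (ball (coding lam i) r))%E.
Proof.
move=> hK hr; rewrite -P_cyl /bernoulli_convolution /pushforward; apply: le_measure; rewrite ?inE.
- exact: measurable_cyl.
- exact: measurable_close_to.
move=> t; rewrite /cyl /= size_mkseq => e.
have agree l : (l < n)%N -> i l = X l t.
  by move=> ln; rewrite -(nth_mkseq false i ln) -e nth_mkseq.
have /andP[l0 l1] := l01.
have l01' : 0 <= lam < 1 by rewrite ltW.
have h := coding_agree l01' agree.
rewrite /ball /=; apply: le_lt_trans h _; apply: lt_le_trans hr.
rewrite mulrC ltr_pM2r ?exprn_gt0//; apply: le_lt_trans hK; rewrite lerDr//.
Qed.

Lemma bernoulli_has_local_dim K i alpha : 1 + lam / (1 - lam) < K ->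
  (forall c, expR (alpha * ln lam) < c -> exists M, forall n,
     hit_mass K p lam (coding lam i) n <= M * c ^+ n) ->
  (forall c, 0 < c < expR (alpha * ln lam) -> exists2 A, 0 < A & forall n,
     A * c ^+ n <= weight p (mkseq i n)) ->
  level_set (bernoulli_convolution lam X) alpha (coding lam i).
Proof.
move=> hK hup hlow; set x := coding lam i.
have /andP[l0 l1] := l01.
pose f r := fine (bernoulli_convolution lam X (ball x r)).
have fE r : bernoulli_convolution lam X (ball x r) = (f r)%:E.
  by rewrite /f fineK//; apply: fin_num_measure; exact: measurable_close_to.
(* Raising the level by [m] absorbs K, since K lam^(n + m) <= lam^n; this only multiplies the
   constant of the lower bound by c^m. *)
have [m hm] : exists m, K * lam ^+ m <= 1.
  have : (GRing.exp lam : R ^nat) @ \oo --> 0 by apply: cvg_expr; rewrite ger0_norm// ltW.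
  have K0 : 0 < K by apply: lt_trans hK; rewrite addr_gt0// divr_gt0// subr_gt0.
  move=> /cvgrPdist_le /(_ K^-1); rewrite invr_gt0 => /(_ K0)[m _ /(_ m (leqnn m))].
  rewrite /= sub0r normrN ger0_norm ?exprn_ge0 ?(ltW l0)// => h; exists m.
  by rewrite mulrC -ler_pdivlMr// mul1r.
have [fpos fcvg] : (forall r, 0 < r < 1 -> 0 < f r) /\
  ln (f r) / ln r @[r --> (0 : R)^'+] --> alpha.
  apply: (local_dim_cvg l01).
  - move=> r r' rr'; rewrite -lee_fin -!fE /bernoulli_convolution /pushforward; apply: le_measure;
      rewrite ?inE; try exact: measurable_close_to.
    by move=> t; apply: le_ball.
  - move=> c /hup[M hM]; exists M => n; rewrite -lee_fin -fE.
    by apply: le_trans (bernoulli_ball_le x n hK) _; rewrite lee_fin.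
  - move=> c c0; have [A A0 hA] := hlow c c0; exists (A * c ^+ m).
      by rewrite mulr_gt0// exprn_gt0//; case/andP: c0.
    move=> n; rewrite -mulrA -exprD; apply: le_trans (hA _) _.
    rewrite -lee_fin -fE; apply: (bernoulli_ball_ge _ hK).
    by rewrite exprD mulrA ger_pMl ?exprn_gt0.
rewrite /level_set /= /has_local_dim.
(* For r in ]0, 1[ the mass is positive, so the extended-real quotient equals the real one. *)
apply: (@cvg_trans _ ((ln (f r) / ln r)%:E @[r --> (0 : R)^'+])); last first.
  by apply: cvg_EFin => //; exact: nearW.
apply: near_eq_cvg; near=> r.
have r0 : 0 < r by near: r; exact: nbhs_right_gt.
have r1 : r < 1 by near: r; exact: nbhs_right_lt.
by rewrite fE lne_EFin ?fpos ?r0// EFinM.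
Unshelve. all: by end_near. Qed.

End bernoulli_local_dim.

(** * Mass distribution principle for the coded digits *)

Section hausdorff_lower_bound.
Context (R : realType).
Notation leb := (@lebesgue_measure R).
Implicit Types (A U : set R) (s : R).

Lemma diam_ge0 U : (0 <= diam U)%E.
Proof. by apply: ereal_sup_ubound; left. Qed.

Lemma dist_le_diam U x y : U x -> U y -> ((`|x - y|)%:E <= diam U)%E.
Proof. by move=> Ux Uy; apply: ereal_sup_ubound; right; exists (x, y). Qed.

Lemma hausdorff_measure0_cover s A e : 0 < e -> hausdorff_measure s A = 0%E ->
  exists U : nat -> set R, [/\ A `<=` \bigcup_n U n,
    forall n, (diam (U n) <= (1 / 2)%:E)%E &
    (\sum_(n <oo) poweR (diam (U n)) s < e%:E)%E].
Proof.
move=> e0 H0.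
have : (hausdorff_premeasure s (1 / 2) A <= 0)%E.
  by rewrite -H0; apply: ereal_sup_ubound; exists (1 / 2) => //=; rewrite divr_gt0.
move=> hle; have : (hausdorff_premeasure s (1 / 2) A < e%:E)%E.
  by apply: le_lt_trans hle _; rewrite lte_fin.
by move=> /ereal_inf_lt[_ [U [AU dU] <-] lt]; exists U.
Qed.

(** For a diameter dd > 0 take lam^(n + 1) <= dd <= lam^n, so that c^n <= lam^(s n) <= lam^(-s)
    dd^s. For dd = 0 no such scale exists; then n is taken large and [eta] absorbs c^n, as c < 1. *)
Lemma power_scale (lam c M s dd eta : R) :
  0 < lam < 1 -> 0 < s -> 0 <= c <= lam `^ s -> 0 <= M -> 0 <= dd <= 1 / 2 -> 0 < eta ->
  exists2 n, dd <= lam ^+ n & M * c ^+ n <= M * lam `^ (- s) * dd `^ s + eta.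
Proof.
move=> l01 s0 /andP[c0 cs] M0 /andP[d0 d2] eta0; have /andP[l0 l1] := l01.
have [dE|dn] := eqVneq dd 0.
  have c1 : c < 1.
    apply: le_lt_trans cs _; rewrite /powR gt_eqF// -expR0 ltr_expR.
    by rewrite nmulr_llt0 // ?ln_lt0 ?l0// mulrC.
  have : (GRing.exp c : R ^nat) @ \oo --> 0 by apply: cvg_expr; rewrite ger0_norm.
  have M1 : 0 < M + 1 by lra.
  move=> /cvgrPdist_le /(_ (eta / (M + 1))); rewrite divr_gt0// => /(_ isT).
  move=> [m _ /(_ m (leqnn m))] /=; rewrite sub0r normrN ger0_norm ?exprn_ge0// => h.
  exists m; first by rewrite dE exprn_ge0// ltW.
  apply: (@le_trans _ _ eta); last by rewrite lerDr !mulr_ge0 ?powR_ge0.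
  rewrite ler_pdivlMr// in h; apply: le_trans h; rewrite mulrDr mulr1 mulrC lerDl.
  exact: exprn_ge0.
have dd01 : 0 < dd < 1 by rewrite lt0r dn d0; lra.
have [n /andP[h1 h2]] := power_bracket l01 dd01.
exists n => //; apply: (@le_trans _ _ (M * lam `^ (- s) * dd `^ s)); last by rewrite lerDl ltW.
rewrite -mulrA; apply: ler_wpM2l => //.
apply: (@le_trans _ _ ((lam `^ s) ^+ n)); first by rewrite lerXn2r ?nnegrE ?powR_ge0.
have -> : (lam `^ s) ^+ n = lam `^ (- s) * (lam ^+ n.+1) `^ s.
  rewrite -(powR_mulrn n.+1 (ltW l0)) powRAC powR_mulrn ?powR_ge0//.
  by rewrite powRN exprS mulrA mulVf ?mul1r// gt_eqF// powR_gt0.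
rewrite ler_pM2l ?powR_gt0// ge0_ler_powR ?nnegrE ?exprn_ge0 ?(ltW s0) ?(ltW l0)//.
Qed.

(** A Frostman condition with a uniform constant, an integer so that countably many of these sets
    exhaust the typical points. *)
Definition slow_points (lam q K c : R) A (M : nat) : set R :=
  [set u | [/\ 0 <= u < 1, A (coding lam (digit q u)) &
    forall n, hit_mass K q lam (coding lam (digit q u)) n <= M%:R * c ^+ n]].

(** Fix one slow point coded into U. Every other one is coded within diam U <= lam^n of it, so its
    cylinder of level n is among those counted by the hit mass of the fixed point. As A is
    arbitrary, a measurable superset F is produced. *)
Lemma cover_slow_points (lam q K c s eta : R) A M U :
  0 < lam < 1 -> 0 < q < 1 -> 1 + lam / (1 - lam) < K -> 0 < s ->
  0 <= c <= lam `^ s -> (diam U <= (1 / 2)%:E)%E -> 0 < eta ->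
  exists F : set R, [/\ measurable F,
    (leb F <= (M%:R * lam `^ (- s))%:E * poweR (diam U) s + eta%:E)%E &
    forall u, slow_points lam q K c A M u -> U (coding lam (digit q u)) -> F u].
Proof.
move=> l01 q01 hK s0 cs dU eta0.
have dfin : diam U \is a fin_num.
  by rewrite ge0_fin_numE ?diam_ge0//; apply: le_lt_trans dU _; exact: ltry.
pose dd := fine (diam U).
have ddE : diam U = dd%:E by rewrite fineK.
have dd2 : 0 <= dd <= 1 / 2 by rewrite -!lee_fin -ddE diam_ge0.
have [n dn hn] := power_scale l01 s0 cs (ler0n R M) dd2 eta0.
have [[u [Gu Uu]]|no] := pselect (exists u, slow_points lam q K c A M u
    /\ U (coding lam (digit q u))); last first.
  exists set0; split => //.
    rewrite measure0 adde_ge0 ?mule_ge0 ?lee_fin ?poweR_ge0 ?(ltW eta0)//.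
    by rewrite mulr_ge0 ?powR_ge0.
  by move=> u Gu Uu; apply: no; exists u.
exists (\big[setU/set0]_(w <- words n | hits K lam (coding lam (digit q u)) n w) cylinder q w).
split.
- by apply: bigsetU_measurable => w _; exact: measurable_cylinder.
- have h := measure_hits_le (mu := leb) K lam (coding lam (digit q u)) n (measurable_cylinder q)
    (fun w => lebesgue_cylinder w q01).
  apply: le_trans h _.
  rewrite ddE poweR_EFin -EFinM -EFinD lee_fin.
  by case: Gu => _ _ /(_ n) h; apply: le_trans h hn.
- move=> v [v01 _ _] Uv.
  apply: (mem_hits (w := mkseq (digit q v) n)); first by rewrite size_mkseq.
    apply: hits_near => //; apply: le_trans dn.
    by rewrite -lee_fin -ddE; exact: dist_le_diam.
  exact: cylinder_digit.
Qed.

(** A cover of A with small sum of diam^s pulls back to a cover of the slow points whose measure is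
    at most [B] times that sum, up to a small error. *)
Lemma slow_points_negligible (lam q K c s : R) A M :
  0 < lam < 1 -> 0 < q < 1 -> 1 + lam / (1 - lam) < K -> 0 < s ->
  0 <= c <= lam `^ s -> hausdorff_measure s A = 0%E ->
  leb.-negligible (slow_points lam q K c A M).
Proof.
move=> l01 q01 hK s0 cs H0.
pose B := M%:R * lam `^ (- s).
have B0 : 0 <= B by rewrite mulr_ge0 ?powR_ge0.
have small k : exists F : set R, [/\ measurable F, (leb F <= (k.+1%:R^-1)%:E)%E &
    slow_points lam q K c A M `<=` F].
  (* The cover contributes at most B e / 2 / (B + 1) <= e / 2, where B + 1 avoids dividing by 0; the
     errors [eta n] add up to e / 2. *)
  pose e : R := k.+1%:R^-1; have e0 : 0 < e by rewrite invr_gt0.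
  have e1 : 0 < e / 2 / (B + 1) by rewrite !divr_gt0// ltr_wpDl.
  have [U [AU dU sumU]] := hausdorff_measure0_cover e1 H0.
  have eta n : 0 < e / 2 / (2 ^ n.+1)%:R by rewrite !divr_gt0// ltr0n expn_gt0.
  have /choice[F hF] := fun n => cover_slow_points A M l01 q01 hK s0 cs (dU n) (eta n).
  have mF n : measurable (F n) by case: (hF n).
  exists (\bigcup_n F n); split.
  - exact: bigcupT_measurable.
  - have mU : measurable (\bigcup_n F n) by exact: bigcupT_measurable.
    apply: le_trans (@measure_sigma_subadditive _ _ _ leb _ F mF mU (@subset_refl _ _)) _.
    apply: (@le_trans _ _ (\sum_(n <oo) (B%:E * poweR (diam (U n)) s
        + (e / 2 / (2 ^ n.+1)%:R)%:E))%E).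
      by apply: lee_nneseries => // n _; case: (hF n).
    apply: le_trans (epsilon_trick _ _ _) _.
    - by move=> n; rewrite mule_ge0 ?lee_fin ?poweR_ge0.
    - by rewrite divr_ge0// ltW.
    rewrite nneseriesZl; last by move=> n _; exact: poweR_ge0.
    apply: (@le_trans _ _ ((e / 2)%:E + (e / 2)%:E)%E); last by rewrite -EFinD lee_fin -splitr.
    apply: leeD => //; apply: (@le_trans _ _ (B%:E * (e / 2 / (B + 1))%:E)%E).
      by apply: lee_wpmul2l; rewrite ?lee_fin// ltW.
    rewrite -EFinM lee_fin mulrA ler_pdivrMr ?ltr_wpDl// mulrC ler_pM2l ?divr_gt0//.
    by rewrite lerDl.
  - move=> u Gu; have [_ Au _] := Gu; have [n _ Un] := AU _ Au.
    by exists n => //; have [_ _] := hF n; apply.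
have /choice[F hF] := small.
have mF n : measurable (F n) by case: (hF n).
exists (\bigcap_n F n); split.
- exact: bigcapT_measurable.
- apply/eqP; rewrite eq_le measure_ge0 andbT; apply/lee_addgt0Pr => e e0.
  have [n hn] : exists n, n.+1%:R^-1 <= e.
    exists (Num.truncn e^-1); rewrite invf_ple ?posrE//; apply/ltW.
    by rewrite truncnS_gt.
  rewrite add0e; apply: (@le_trans _ _ (leb (F n))).
    apply: le_measure; rewrite ?inE; [exact: bigcapT_measurable|exact: mF|].
    by move=> u h; exact: h.
  by have [_ h _] := hF n; apply: le_trans h _; rewrite lee_fin.
- by move=> u Gu n _; have [_ _] := hF n; apply.
Qed.

(** Otherwise [0, 1[ would be covered, up to a null set, by the countably many negligible sets of
    slow points. *)
Lemma hausdorff_measure_neq0 (lam q K c s : R) A :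
  0 < lam < 1 -> 0 < q < 1 -> 1 + lam / (1 - lam) < K -> 0 < s ->
  0 <= c <= lam `^ s ->
  {ae leb, forall u, 0 <= u < 1 -> A (coding lam (digit q u)) /\
    exists M, forall n,
      hit_mass K q lam (coding lam (digit q u)) n <= M * c ^+ n} ->
  hausdorff_measure s A <> 0%E.
Proof.
move=> l01 q01 hK s0 cs hA H0.
have neg := negligible_bigcup (fun M => slow_points_negligible M l01 q01 hK s0 cs H0).
have : leb.-negligible (`[0, 1[%classic : set R).
  apply: negligibleS (negligibleU hA neg) => u; rewrite /= in_itv /= => u01.
  have [h|h] := pselect (0 <= u < 1 -> A (coding lam (digit q u)) /\
    exists M, forall n,
      hit_mass K q lam (coding lam (digit q u)) n <= M * c ^+ n); last by left.
  right; have [Au [M hM]] := h u01.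
  exists (Num.truncn `|M|).+1 => //; split => // n; apply: le_trans (hM n) _.
  apply: ler_wpM2r; first by rewrite exprn_ge0//; case/andP: cs.
  by apply: (le_trans (ler_norm _)); rewrite ltW// truncnS_gt.
move=> neg01; have : leb (`[0, 1[%classic : set R) = 0%E.
  by apply/negligibleP => //; exact: measurable_itv.
by rewrite lebesgue_measure_itv /= lte_fin ltr01 -EFinD subr0 => /eqP; rewrite eqe oner_eq0.
Qed.

Lemma le_hausdorff_dim (t : \bar R) A :
  (forall s, 0 < s -> (s%:E < t)%E -> hausdorff_measure s A <> 0%E) ->
  (t <= hausdorff_dim A)%E.
Proof.
move=> h; apply: le_ereal_inf_tmp => _ [s [s0 H0] <-].
by rewrite leNgt; apply/negP => st; exact: (h s s0 st H0).
Qed.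

End hausdorff_lower_bound.

(** * Almost everywhere statements and affine changes of variable *)

Section almost_everywhere.
Context (R : realType).
Notation leb := (@lebesgue_measure R).

Lemma ae_forall_countable (T : countType) d (S : measurableType d)
    (mu : {measure set S -> \bar R}) (Q : T -> S -> Prop) :
  (forall t, {ae mu, forall x, Q t x}) -> {ae mu, forall x, forall t, Q t x}.
Proof.
move=> h.
have : {ae mu, forall x, forall n, if choice.unpickle n is Some t then Q t x else True}.
  apply/ae_foralln => n; case: (choice.unpickle n) => [t|]; first exact: h.
  by apply: aeW.
by apply: filterS => x hx t; have := hx (choice.pickle t); rewrite choice.pickleK.
Qed.

Lemma ae_lebesgue_forall (T : countType) (Q : T -> R -> Prop) :
  (forall t, {ae leb, forall x, Q t x}) -> {ae leb, forall x, forall t, Q t x}.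
Proof. exact: (@ae_forall_countable T _ _ leb Q). Qed.

Lemma ae_lebesgueS (Q Q' : R -> Prop) : (forall x, Q x -> Q' x) ->
  {ae leb, forall x, Q x} -> {ae leb, forall x, Q' x}.
Proof. by move=> QQ'; apply: negligibleS => x /= nQ' Qx; exact/nQ'/QQ'. Qed.

Lemma ae_lebesgueS2 (Q1 Q2 Q' : R -> Prop) : (forall x, Q1 x -> Q2 x -> Q' x) ->
  {ae leb, forall x, Q1 x} -> {ae leb, forall x, Q2 x} -> {ae leb, forall x, Q' x}.
Proof.
move=> QQ' h1 h2; apply: negligibleS (negligibleU h1 h2) => x /= nQ'.
by apply: contrapT => /not_orP[/contrapT q1 /contrapT q2]; exact/nQ'/QQ'.
Qed.

(** The image of Lebesgue measure under the map, multiplied by a, gives each interval ]x, y] its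
    length, so by uniqueness it is Lebesgue measure. *)
Lemma lebesgue_measure_affine (a b : R) (A : set R) : 0 < a -> measurable A ->
  leb ((fun x => a * x + b) @^-1` A) = ((a^-1)%:E * leb A)%E.
Proof.
move=> a0 mA.
pose f : measurableTypeR R -> measurableTypeR R := fun x => a * (x : R) + b.
have mf : measurable_fun setT f.
  by apply: measurable_funD => //; apply: measurable_funM.
pose mu := mscale (NngNum (ltW a0)) (pushforward leb f).
have muE : leb A = mu mf A.
  apply: lebesgue_measure_unique => //= _ [[x y]] _ <-.
  have preE : f @^-1` `]x, y]%classic = `](x - b) / a, (y - b) / a]%classic.
    apply/seteqP; split=> z /=; rewrite /f !in_itv /= ltr_pdivrMr// ler_pdivlMr//
      ltrBlDr lerBrDr mulrC//.
  transitivity (a%:E * leb (f @^-1` `]x, y]%classic))%E; last by [].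
  rewrite preE !lebesgue_measure_itv /= !lte_fin ltr_pM2r ?invr_gt0// ltrBlDr subrK.
  case: ifP => _; last by rewrite mule0.
  rewrite -!EFinD -EFinM; congr (_%:E); field.
  by rewrite gt_eqF.
rewrite muE /mu /mscale /pushforward /= muleA -EFinM mulVf ?gt_eqF// mul1e.
by [].
Qed.

Lemma ae_affine (a b : R) (Q : R -> Prop) : 0 < a ->
  {ae leb, forall x, Q x} -> {ae leb, forall x, Q (a * x + b)}.
Proof.
move=> a0 [N [mN N0 hN]]; exists ((fun x => a * x + b) @^-1` N); split.
- rewrite -[X in measurable X]setTI.
  have mf : measurable_fun setT (fun x : R => a * x + b).
    by apply: measurable_funD => //; apply: measurable_funM.
  exact: mf.
- by apply: etrans (lebesgue_measure_affine b a0 mN) _; rewrite [X in (_ * X)%E]N0 mule0.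
- by move=> x nQ; exact: hN.
Qed.

End almost_everywhere.

(** * Growth rates along typical digit sequences *)

Section typical_digits.
Context (R : realType).
Notation leb := (@lebesgue_measure R).

(** The weight divided by c^n is a product of factors r / c and (1 - r) / c, whose mean logarithm
    under bias q is negative. *)
Lemma ae_weight_le (r q c : R) : 0 < r < 1 -> 0 < q < 1 -> 0 < c ->
  q * ln r + (1 - q) * ln (1 - r) < ln c ->
  {ae leb, forall u, 0 <= u < 1 -> exists A : nat, forall n,
    weight r (mkseq (digit q u) n) <= A%:R * c ^+ n}.
Proof.
move=> /andP[r0 r1] q01 c0 h; have r1' : 0 < 1 - r by rewrite subr_gt0.
have h' : q * ln (r / c) + (1 - q) * ln ((1 - r) / c) < 0.
  by rewrite !ln_div ?posrE//; lra.
have := ae_prod_digit_bounded q01 (divr_gt0 r0 c0) (divr_gt0 r1' c0) h'.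
apply: ae_lebesgueS => u H u01; have [A hA] := H u01.
exists (Num.truncn `|A|).+1 => n.
have -> : weight r (mkseq (digit q u) n) = (\prod_(x <- mkseq (digit q u) n)
    (if x then (1 - r) / c else r / c)) * c ^+ n.
  rewrite -[in c ^+ n](size_mkseq (digit q u) n) /weight.
  elim: (mkseq _ _) => [|x w IH]; first by rewrite !big_nil mulr1.
  rewrite !big_cons IH /= exprS; case: (x) => /=; field; exact: lt0r_neq0.
apply: ler_wpM2r; first by rewrite exprn_ge0// ltW.
apply: le_trans (hA n) _; apply: (le_trans (ler_norm _)).
by rewrite ltW// truncnS_gt.
Qed.

(** Same argument with the inverse factors c / r and c / (1 - r). *)
Lemma ae_weight_ge (r q c : R) : 0 < r < 1 -> 0 < q < 1 -> 0 < c ->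
  ln c < q * ln r + (1 - q) * ln (1 - r) ->
  {ae leb, forall u, 0 <= u < 1 -> exists2 A : R, 0 < A & forall n,
    A * c ^+ n <= weight r (mkseq (digit q u) n)}.
Proof.
move=> /andP[r0 r1] q01 c0 h; have r1' : 0 < 1 - r by rewrite subr_gt0.
have h' : q * ln (c / r) + (1 - q) * ln (c / (1 - r)) < 0.
  by rewrite !ln_div ?posrE//; lra.
have := ae_prod_digit_bounded q01 (divr_gt0 c0 r0) (divr_gt0 c0 r1') h'.
apply: ae_lebesgueS => u H u01; have [A hA] := H u01.
have A0 : 0 < A by have := hA 0%N; rewrite big_nil; apply: lt_le_trans.
exists A^-1; first by rewrite invr_gt0.
move=> n; rewrite mulrC ler_pdivrMr//; apply: le_trans (_ : _ <= weight r
   (mkseq (digit q u) n) * \prod_(x <- mkseq (digit q u) n)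
    (if x then c / (1 - r) else c / r)) _.
  rewrite -[in c ^+ n](size_mkseq (digit q u) n) /weight.
  elim: (mkseq _ _) => [|x w IH]; first by rewrite !big_nil mulr1.
  rewrite !big_cons /= mulrACA exprS; apply: ler_pM => //.
  - exact: ltW.
  - by rewrite exprn_ge0// ltW.
  - by case: (x) => /=; rewrite mulrC divfK// gt_eqF.
by apply: ler_wpM2l (hA n); apply: weight_ge0; apply/andP; split; exact: ltW.
Qed.

(** Rational rates give one null set for all c; a real c is replaced by a rational between c and
    E. *)
Lemma ae_forall_weight_ge (r q E : R) : 0 < r < 1 -> 0 < q < 1 -> 0 < E ->
  ln E = q * ln r + (1 - q) * ln (1 - r) ->
  {ae leb, forall u, 0 <= u < 1 -> forall c : R, 0 < c < E -> exists2 A : R, 0 < A & forall n,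
    A * c ^+ n <= weight r (mkseq (digit q u) n)}.
Proof.
move=> r01 q01 E0 lnE.
have : {ae leb, forall u, forall c : rat, 0 < (ratr c : R) < E -> 0 <= u < 1 ->
  exists2 A : R, 0 < A & forall n, A * ratr c ^+ n <= weight r (mkseq (digit q u) n)}.
  apply: ae_lebesgue_forall => c.
  have [/andP[c0 cE]|h] := boolP (0 < (ratr c : R) < E); last by apply: aeW.
  have := @ae_weight_ge r q (ratr c) r01 q01 c0.
  by rewrite -lnE ltr_ln ?posrE// => /(_ cE); apply: ae_lebesgueS.
apply: ae_lebesgueS => u H u01 c /andP[c0 cE].
have [c' ] := rat_in_itvoo cE; rewrite in_itv /= => /andP[cc' c'E].
have [|A A0 hA] := H c' _ u01; first by rewrite (lt_trans c0).
exists A => // n; apply: le_trans (hA n); rewrite ler_pM2l//.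
by rewrite lerXn2r ?nnegrE ?ltW// (lt_trans c0).
Qed.

(** The triple is (b, c1, c2); rational triples keep the number of null sets countable. *)
Definition good_pair (K lstar : R) (pf : R -> R) (lam q : R) : Prop :=
  forall t : rat * rat * rat,
    0 < (ratr t.1.1 : R) <= lstar -> (ratr t.1.1 : R) < (ratr t.1.2 : R) < (ratr t.2 : R) ->
    {ae leb, forall u, ~ exceptional K (ratr t.1.1) (ratr t.1.2) (ratr t.2) pf ((lam, q), u)}.

Lemma ae_good_pair (K lstar : R) (pf : R -> R) :
  transversality lstar -> 0 < K -> lstar < 1 ->
  measurable_fun setT pf -> (forall q : R, 0 < q < 1 -> 0 < pf q < 1) ->
  {ae leb, forall lam, {ae leb, forall q, good_pair K lstar pf lam q}}.
Proof.
move=> tr K0 l1 mpf pf01.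
have : {ae leb, forall lam, forall t : rat * rat * rat, {ae leb, forall q,
    0 < (ratr t.1.1 : R) <= lstar -> (ratr t.1.1 : R) < (ratr t.1.2 : R) < (ratr t.2 : R) ->
    {ae leb, forall u, ~ exceptional K (ratr t.1.1) (ratr t.1.2) (ratr t.2) pf ((lam, q), u)}}}.
  apply: ae_lebesgue_forall => t.
  have [h1|h1] := boolP (0 < (ratr t.1.1 : R) <= lstar); last first.
    by apply: aeW => lam; apply: aeW.
  have [h2|h2] := boolP ((ratr t.1.1 : R) < (ratr t.1.2 : R) < (ratr t.2 : R)); last first.
    by apply: aeW => lam; apply: aeW.
  have := exceptional_null tr K0 h1 l1 mpf pf01 h2.
  by apply: ae_lebesgueS => lam; apply: ae_lebesgueS.
by apply: ae_lebesgueS => lam; exact: ae_lebesgue_forall.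
Qed.

(** Since lam <= E < c, there are rationals E < c1 < c2 < c and lam < b < c1 with b < lstar. The
    weights of typical digits grow at most like c1^n, so avoiding the exceptional set forces the
    bound on the hit masses. *)
Lemma good_pair_hit_mass (K lstar : R) (pf : R -> R) lam q E :
  0 < lam < lstar -> 0 < q < 1 -> 0 < pf q < 1 -> lam <= E ->
  ln E = q * ln (pf q) + (1 - q) * ln (1 - pf q) ->
  good_pair K lstar pf lam q ->
  {ae leb, forall u, 0 <= u < 1 -> forall c : R, E < c -> exists M, forall n,
     hit_mass K (pf q) lam (coding lam (digit q u)) n <= M * c ^+ n}.
Proof.
move=> /andP[l0 ll] q01 r01 lE lnE good.
have E0 : 0 < E by exact: lt_le_trans lE.
have H1 : {ae leb, forall u, forall t : rat * rat * rat,
    0 < (ratr t.1.1 : R) <= lstar -> (ratr t.1.1 : R) < (ratr t.1.2 : R) < (ratr t.2 : R) ->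
    ~ exceptional K (ratr t.1.1) (ratr t.1.2) (ratr t.2) pf ((lam, q), u)}.
  apply: ae_lebesgue_forall => t.
  have [h1|h1] := boolP (0 < (ratr t.1.1 : R) <= lstar); last by apply: aeW.
  have [h2|h2] := boolP ((ratr t.1.1 : R) < (ratr t.1.2 : R) < (ratr t.2 : R)); last by apply: aeW.
  by have := good t h1 h2; apply: ae_lebesgueS.
have H2 : {ae leb, forall u, forall c : rat, E < (ratr c : R) -> 0 <= u < 1 ->
    exists A : nat, forall n, weight (pf q) (mkseq (digit q u) n) <= A%:R * ratr c ^+ n}.
  apply: ae_lebesgue_forall => c.
  have [cE|h] := boolP (E < (ratr c : R)); last by apply: aeW.
  have c0 : 0 < (ratr c : R) by exact: lt_trans cE.
  have := @ae_weight_le _ q (ratr c) r01 q01 c0.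
  by rewrite -lnE ltr_ln ?posrE// => /(_ cE); apply: ae_lebesgueS.
apply: ae_lebesgueS2 H1 H2 => u H1 H2 u01 c Ec.
have [c2 ] := rat_in_itvoo Ec; rewrite in_itv /= => /andP[Ec2 c2c].
have [c1 ] := rat_in_itvoo Ec2; rewrite in_itv /= => /andP[Ec1 c12].
have : lam < Num.min (ratr c1 : R) lstar by rewrite lt_min ll (le_lt_trans lE).
move=> /rat_in_itvoo[b]; rewrite in_itv /= lt_min => /andP[lb /andP[bc1 bl]].
have b0 : 0 < (ratr b : R) <= lstar by rewrite (lt_trans l0 lb)/= ltW.
have bc : (ratr b : R) < (ratr c1 : R) < (ratr c2 : R) by rewrite bc1.
have := H1 (b, c1, c2) b0 bc => /= nex.
have [M hM] : exists M : nat, forall n,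
    hit_mass K (pf q) lam (coding lam (digit q u)) n <= M%:R * ratr c2 ^+ n.
  apply: contrapT => h; apply: nex; split => //=; first by rewrite l0.
  exact: H2.
exists M%:R => n; apply: le_trans (hM n) _; apply: ler_wpM2l => //.
have c20 : 0 < (ratr c2 : R) by exact: lt_trans Ec2.
by rewrite lerXn2r ?nnegrE ?ltW// (lt_trans c20).
Qed.

End typical_digits.

(** * Dimension of the level sets and the final change of variable *)

Section level_sets.
Context (R : realType).
Notation leb := (@lebesgue_measure R).

(** Apply ln z <= z - 1 to z = p / q and z = (1 - p) / (1 - q); the right sides, weighted by q and 1
    - q, cancel. *)
Lemma gibbs (p q : R) : 0 < p < 1 -> 0 < q < 1 ->
  q * ln p + (1 - q) * ln (1 - p) <= - entropy q.
Proof.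
have step (x y : R) : 0 < x -> 0 < y -> y * (ln x - ln y) <= x - y.
  move=> x0 y0; have xy : 0 < x / y by rewrite divr_gt0.
  have := @le_ln1Dx R (x / y - 1).
  rewrite (_ : 1 + (x / y - 1) = x / y); last by ring.
  rewrite ltrBrDl subrr => /(_ xy).
  rewrite ln_div ?posrE// => h.
  have -> : x - y = y * (x / y - 1) by field; rewrite gt_eqF.
  by rewrite ler_pM2l.
move=> /andP[p0 p1] /andP[q0 q1].
have p1' : 0 < 1 - p by rewrite subr_gt0.
have q1' : 0 < 1 - q by rewrite subr_gt0.
have := step p q p0 q0; have := step _ _ p1' q1'.
by rewrite /entropy; lra.
Qed.

Lemma entropy_gt0 (q : R) : 0 < q < 1 -> 0 < entropy q.
Proof.
move=> /andP[q0 q1]; have := ln_lt0 (introT andP (conj q0 q1)).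
have : ln (1 - q) < 0 by rewrite ln_lt0//; lra.
by rewrite /entropy; nra.
Qed.

(** Typical u are coded into the level set by [H1] (ball masses from above) and [H3] (cylinders from
    below), while [H2], the case of bias q, feeds the mass distribution principle. The constant K is
    tied to lstar so that it serves every lam < lstar. *)
Lemma level_set_dim (lstar p lam alpha q : R) (d : measure_display)
    (Omega : measurableType d) (P : probability Omega R)
    (X : nat -> {RV P >-> bool}) :
  lstar < 1 -> 0 < p < 1 -> biased_iid_digits p X ->
  0 < lam < lstar -> 0 < q < 1 -> alpha <= 1 ->
  alpha * ln lam = q * ln p + (1 - q) * ln (1 - p) ->
  good_pair (1 + 1 / (1 - lstar)) lstar (fun=> p) lam q ->
  good_pair (1 + 1 / (1 - lstar)) lstar id lam q ->
  ((entropy q / `|ln lam|)%:E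
     <= hausdorff_dim (level_set (bernoulli_convolution lam X) alpha))%E.
Proof.
move=> ls1 p01 hX lls q01 a1 hq goodp goodq; have /andP[l0 ll] := lls.
set K := 1 + 1 / (1 - lstar) in goodp goodq.
have l1 : lam < 1 by exact: lt_trans ls1.
have l01 : 0 < lam < 1 by rewrite l0.
have hK : 1 + lam / (1 - lam) < K.
  rewrite /K ltrD2l; apply: (@lt_trans _ _ (1 / (1 - lam))).
    by rewrite ltr_pM2r ?invr_gt0 ?subr_gt0.
  by rewrite ltr_pM2l// ltf_pV2 ?posrE ?subr_gt0// ltrD2l ltrN2.
have lnl : ln lam < 0 by rewrite ln_lt0.
(* As alpha <= 1, lam <= lam^alpha; Gibbs' inequality then gives lam <= exp(-h(q)), so both growth
   rates are admissible. *)
have al : ln lam <= alpha * ln lam by rewrite ler_nMl.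
have gb := gibbs p01 q01; rewrite -hq in gb.
have lamE : lam <= expR (alpha * ln lam) by rewrite -{1}(@lnK _ lam) ?posrE// ler_expR.
have lamEq : lam <= expR (- entropy q).
  by rewrite -{1}(@lnK _ lam) ?posrE// ler_expR; exact: le_trans gb.
have Eq : ln (expR (- entropy q)) = q * ln q + (1 - q) * ln (1 - q).
  by rewrite expRK /entropy; ring.
have Ep : ln (expR (alpha * ln lam)) = q * ln p + (1 - q) * ln (1 - p).
  by rewrite expRK.
have H1 := good_pair_hit_mass (pf := fun=> p) lls q01 p01 lamE Ep goodp.
have H2 := good_pair_hit_mass (pf := id) lls q01 q01 lamEq Eq goodq.
have H3 := ae_forall_weight_ge p01 q01 (expR_gt0 _) Ep.
apply: le_hausdorff_dim => s s0; rewrite lte_fin ltr0_norm// => hs.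
apply: (hausdorff_measure_neq0 (c := lam `^ s) l01 q01 hK s0).
  by rewrite powR_ge0 lexx.
(* This is where s < h(q) / |log lam| enters. *)
have clt : expR (- entropy q) < lam `^ s.
  rewrite /powR gt_eqF// ltr_expR.
  by move: hs; rewrite ltr_pdivlMr ?oppr_gt0//; lra.
apply: ae_lebesgueS2 (ae_lebesgueS2 (fun u a b => conj a b) H1 H2) H3.
move=> u [h1 h2] h3 u01; split; last exact: h2 u01 _ clt.
exact: (bernoulli_has_local_dim hX l01 hK (h1 u01) (h3 u01)).
Qed.

End level_sets.

Theorem theorem1p9 (R : realType)
    (lstar : R) (hlstar : 1 / 2 < lstar < 1) (htrans : transversality lstar)
    (p : R) (hp : 0 < p < 1 / 2)
    (d : measure_display) (Omega : measurableType d) (P : probability Omega R)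
    (X : nat -> {RV P >-> bool}) (hX : biased_iid_digits p X) :
  {ae lebesgue_measure, forall lam : R,
    lam \in `]1 / 2, Num.min lstar (1 - p)[ ->
    {ae lebesgue_measure, forall alpha : R,
      alpha \in `[ln (1 - p) / ln lam, 1] ->
      (0 < hausdorff_dim
             (level_set (bernoulli_convolution lam X) alpha))%E}
    /\
    {ae lebesgue_measure, forall alpha : R,
      alpha \in `[ln (1 - p) / ln lam, 1] ->
      forall q : R, alpha * ln lam = q * ln p + (1 - q) * ln (1 - p) ->
      ((entropy q / `|ln lam|)%:E
         <= hausdorff_dim
              (level_set (bernoulli_convolution lam X) alpha))%E}}.
Proof.
have /andP[ls2 ls1] := hlstar; have /andP[p0 p2] := hp.
have p01 : 0 < p < 1 by rewrite p0 (lt_trans p2)//; lra.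
have K0 : 0 < 1 + 1 / (1 - lstar) by rewrite addr_gt0// divr_gt0// subr_gt0.
have Hp := ae_good_pair htrans K0 ls1 (@measurable_cst _ _ R R setT p) (fun _ _ => p01).
have Hq := ae_good_pair htrans K0 ls1 (@measurable_id _ R setT) (fun _ h => h).
apply: ae_lebesgueS2 Hp Hq => lam Hp Hq.
rewrite in_itv /= lt_min => /andP[l2 /andP[lls lp]].
have l0 : 0 < lam by apply: lt_trans l2; lra.
have l1 : lam < 1 by exact: lt_trans ls1.
have lnl : ln lam < 0 by rewrite ln_lt0// l0.
have lnp : ln p < ln (1 - p) by rewrite ltr_ln ?posrE//; lra.
have lnp2 : ln p < ln lam by rewrite ltr_ln ?posrE// (lt_trans p2).
have den : ln p - ln (1 - p) < 0 by lra.
(* Solving the affine relation for q gives q = a alpha + b. *)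
pose a := ln lam / (ln p - ln (1 - p)); pose b := - ln (1 - p) / (ln p - ln (1 - p)).
have a0 : 0 < a by rewrite nmulr_rgt0// invr_lt0.
have Hpq := ae_affine b a0 (ae_lebesgueS2 (fun u h1 h2 => conj h1 h2) Hp Hq).
(* The left endpoint corresponds to q = 0 and is discarded as a null set. *)
have ne : {ae lebesgue_measure, forall alpha : R, alpha <> ln (1 - p) / ln lam}.
  exists [set ln (1 - p) / ln lam]; split => //.
  - exact: lebesgue_measure_set1.
  - by move=> alpha /= /contrapT ->.
have dim_bound : {ae lebesgue_measure, forall alpha : R,
    alpha \in `[ln (1 - p) / ln lam, 1] -> exists q,
    [/\ 0 < q < 1, alpha * ln lam = q * ln p + (1 - q) * ln (1 - p) &
     ((entropy q / `|ln lam|)%:E <= hausdorff_dim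
              (level_set (bernoulli_convolution lam X) alpha))%E]}.
  apply: ae_lebesgueS2 Hpq ne => alpha [goodp goodq] ne.
  rewrite in_itv /= => /andP[h1 h2]; exists (a * alpha + b).
  have hq : alpha * ln lam = (a * alpha + b) * ln p + (1 - (a * alpha + b)) * ln (1 - p).
    by rewrite /a /b; field; rewrite lt_eqF.
  have lt1 : alpha * ln lam < ln (1 - p).
    by rewrite -ltr_ndivrMr// lt_neqAle h1 eq_sym andbT; exact/eqP.
  have ge1 : ln lam <= alpha * ln lam by rewrite ler_nMl.
  (* q > 0 because alpha is not the left endpoint; q < 1 because alpha log lam >= log lam > log p,
     as p < 1/2 < lam. *)
  have q01 : 0 < a * alpha + b < 1.
    apply/andP; split.
      rewrite ltNge; apply/negP => q0; have := lt1; rewrite hq; nra.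
    rewrite ltNge; apply/negP => q1.
    have : (a * alpha + b) * ln p + (1 - (a * alpha + b)) * ln (1 - p) <= ln p by nra.
    by rewrite -hq; lra.
  split => //; apply: (level_set_dim ls1 p01 hX) => //.
  by rewrite l0.
split.
  apply: ae_lebesgueS dim_bound => alpha H /H[q [q01 _]]; apply: lt_le_trans.
  by rewrite lte_fin divr_gt0 ?entropy_gt0// normr_gt0 lt_eqF.
apply: ae_lebesgueS dim_bound => alpha H /H[q [q01 hq hdim]] q' hq'.
(* The relation determines q, since log p and log (1 - p) differ. *)
suff -> : q' = q by [].
have : (q' - q) * (ln p - ln (1 - p)) = 0 by rewrite hq in hq'; lra.
by move/eqP; rewrite mulf_eq0 subr_eq0 [_ - _ == 0]lt_eqF// orbF => /eqP.
Qed.
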